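(* Over ZF, the axiom of choice is equivalent to the maximum principle (for all partial orders): for every partial order $\mathbb{P}=(\mathbb{P},\unlhd)$, every $p\in\mathbb{P}$, and every formula $\theta(x)$ of the forcing language of $\mathbb{P}$ (a formula of set theory which may have $\mathbb{P}$-names as parameters), $$p\Vdash\exists x\,\theta(x)\quad\text{iff}\quad\text{there exists a }\mathbb{P}\text{-name }\tau\text{ such that } p\Vdash\theta(\tau).$$
   Context: For a partial order $(\mathbb{P},\unlhd)$ (smaller elements are stronger conditions), $\mathbb{P}$-names are defined recursively as sets of pairs $(p,\sigma)$ with $p\in\mathbb{P}$ and $\sigma$ a $\mathbb{P}$-name. The relation $p\Vdash\varphi$ is the usual forcing relation, defined in ZF (no choice assumed in the ground model) by recursion on formulas; the existential clause is $$p\Vdash\exists x\,\theta(x)\quad\text{iff}\quad\forall q\unlhd p\;\exists r\unlhd q\;\exists\tau\;\; r\Vdash\theta(\tau),$$ where $p,q,r$ range over $\mathbb{P}$ and $\tau$ ranges over $\mathbb{P}$-names. The maximum principle is understood as a scheme, with one instance for each formula $\theta$. *)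

(* Defs.v *)
(** ** Models of ZF *)

Record mem_structure := { carrier :> Type; mem : carrier -> carrier -> Prop }.
Arguments mem {m} _ _.
Notation "x ∈ y" := (mem x y) (at level 70, no associativity).

(** Formulas of the language of set theory in de Bruijn style: index 0 is the
    variable bound by the innermost [Ex].  The other connectives and the
    universal quantifier are the usual abbreviations. *)
Inductive formula : Set :=
| Mem (i j : nat)
| Eq (i j : nat)
| Neg (phi : formula)
| And (phi psi : formula)
| Ex (phi : formula).

Definition scons {A : Type} (x : A) (rho : nat -> A) (n : nat) : A :=
  match n with 0 => x | S k => rho k end.

Fixpoint sat (M : mem_structure) (rho : nat -> M) (phi : formula) : Prop :=
  match phi with
  | Mem i j => rho i ∈ rho j
  | Eq i j => rho i = rho j
  | Neg psi => ~ sat M rho psi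
  | And psi chi => sat M rho psi /\ sat M rho chi
  | Ex psi => exists x : M, sat M (scons x rho) psi
  end.

Definition is_upair {M : mem_structure} (x y z : M) : Prop :=
  forall u, u ∈ z <-> u = x \/ u = y.

(** [z] is the Kuratowski pair [(x, y)] of [M]. *)
Definition is_opair {M : mem_structure} (x y z : M) : Prop :=
  exists a b, is_upair x x a /\ is_upair x y b /\ is_upair a b z.

Definition pair_in {M : mem_structure} (x y r : M) : Prop :=
  exists z, is_opair x y z /\ z ∈ r.

Definition triple_in {M : mem_structure} (x y z r : M) : Prop :=
  exists t, is_opair y z t /\ pair_in x t r.

(** First-order ZF; the environment [rho] supplies the parameters of an
    instance of separation or replacement. *)
Record ZF (M : mem_structure) : Prop := {
  ZF_extensionality : forall x y : M, (forall z, z ∈ x <-> z ∈ y) -> x = y;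
  ZF_foundation : forall x : M, (exists y, y ∈ x) ->
    exists y, y ∈ x /\ forall z, ~ (z ∈ x /\ z ∈ y);
  ZF_pairing : forall x y : M, exists z, is_upair x y z;
  ZF_union : forall x : M, exists u, forall z,
    z ∈ u <-> exists y, z ∈ y /\ y ∈ x;
  ZF_power : forall x : M, exists w, forall y,
    y ∈ w <-> forall z, z ∈ y -> z ∈ x;
  ZF_infinity : exists w : M,
    (exists e, e ∈ w /\ forall z, ~ z ∈ e) /\
    forall x, x ∈ w -> exists s, s ∈ w /\ forall z, z ∈ s <-> z ∈ x \/ z = x;
  ZF_separation : forall (phi : formula) (rho : nat -> M) (a : M),
    exists b, forall x, x ∈ b <-> x ∈ a /\ sat M (scons x rho) phi;
  ZF_replacement : forall (phi : formula) (rho : nat -> M) (a : M),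
    (forall x, x ∈ a -> exists! y, sat M (scons x (scons y rho)) phi) ->
    exists b, forall y,
      y ∈ b <-> exists x, x ∈ a /\ sat M (scons x (scons y rho)) phi
}.

Definition is_function_on {M : mem_structure} (f d : M) : Prop :=
  (forall z, z ∈ f -> exists x y, x ∈ d /\ is_opair x y z) /\
  (forall x, x ∈ d -> exists! y, pair_in x y f).

(** Every family of nonempty sets of [M] has a choice function in [M]. *)
Definition axiom_of_choice (M : mem_structure) : Prop :=
  forall F : M, (forall x, x ∈ F -> exists y, y ∈ x) ->
  exists f, is_function_on f F /\
    forall x, x ∈ F -> exists y, pair_in x y f /\ y ∈ x.

(** ** Forcing inside a model *)

Definition partial_order {M : mem_structure} (P le : M) : Prop :=
  (forall z, z ∈ le -> exists p q, p ∈ P /\ q ∈ P /\ is_opair p q z) /\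
  (forall p, p ∈ P -> pair_in p p le) /\
  (forall p q r, pair_in p q le -> pair_in q r le -> pair_in p r le) /\
  (forall p q, pair_in p q le -> pair_in q p le -> p = q).

Section Forcing.

Context {M : mem_structure} (P le : M).

Definition stronger (q p : M) : Prop := q ∈ P /\ pair_in q p le.

(** The recursive definition of names is carried out inside [M], whose
    membership relation need not be well founded from outside: [x] is a name
    iff it belongs to a set [T] of [M] each of whose elements is a set of pairs
    [(p, s)] with [p ∈ P] and [s ∈ T]. *)
Definition name_closed (T : M) : Prop :=
  forall y z, y ∈ T -> z ∈ y -> exists p s, p ∈ P /\ s ∈ T /\ is_opair p s z.

Definition is_name (x : M) : Prop := exists T, x ∈ T /\ name_closed T.

(** The usual clauses for atomic formulas, relative to a candidate
    [eqf p a b] for [p ⊩ a = b]: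
    - [p ⊩ a ∈ b] iff the set of [r] such that [r ⊴ s] and [r ⊩ a = c] for some
      [(s, c) ∈ b] is dense below [p];
    - [p ⊩ a = b] iff every [q ⊴ p] forces the same elements of
      [dom a ∪ dom b] into [a] and into [b]. *)
Definition mem_clause (eqf : M -> M -> M -> Prop) (p a b : M) : Prop :=
  forall q, stronger q p -> exists r, stronger r q /\
    exists s c, pair_in s c b /\ stronger r s /\ eqf r a c.

Definition eq_clause (eqf : M -> M -> M -> Prop) (p a b : M) : Prop :=
  forall c, (exists s, pair_in s c a \/ pair_in s c b) ->
  forall q, stronger q p -> (mem_clause eqf q c a <-> mem_clause eqf q c b).

(** [eq_clause] is a recursion for [p ⊩ a = b] once [mem_clause] is expanded.
    As for any recursion on sets, its solution is the union of the set-sized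
    partial solutions: here [E] is a set of [M] obeying the recursion for all
    names from a set [T] closed under passing to the names occurring in them. *)
Definition eq_attempt (T E : M) : Prop :=
  name_closed T /\
  forall p a b, p ∈ P -> a ∈ T -> b ∈ T ->
    (triple_in p a b E <-> eq_clause (fun p a b => triple_in p a b E) p a b).

Definition forces_eq (p a b : M) : Prop :=
  exists T E, eq_attempt T E /\ a ∈ T /\ b ∈ T /\ triple_in p a b E.

Definition forces_mem (p a b : M) : Prop := mem_clause forces_eq p a b.

(** [forces phi rho p] is [p ⊩ phi], the free variables of [phi] being
    interpreted by the names [rho]. *)
Fixpoint forces (phi : formula) (rho : nat -> M) (p : M) : Prop :=
  match phi with
  | Mem i j => forces_mem p (rho i) (rho j)
  | Eq i j => forces_eq p (rho i) (rho j)
  | Neg psi => forall q, stronger q p -> ~ forces psi rho q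
  | And psi chi => forces psi rho p /\ forces chi rho p
  | Ex psi => forall q, stronger q p -> exists r, stronger r q /\
      exists t, is_name t /\ forces psi (scons t rho) r
  end.

End Forcing.

(** The instance of the maximum principle for [theta], whose free variable [x]
    is index 0 and whose remaining variables stand for name parameters. *)
Definition maximum_principle_for (M : mem_structure) (theta : formula) : Prop :=
  forall P le : M, partial_order P le ->
  forall p, p ∈ P ->
  forall rho : nat -> M, (forall n, is_name P (rho n)) ->
    (forces P le (Ex theta) rho p <->
     exists t, is_name P t /\ forces P le theta (scons t rho) p).

Definition maximum_principle (M : mem_structure) : Prop :=
  forall theta : formula, maximum_principle_for M theta.

(* Main.v *)
From Stdlib Require Import Classical ClassicalEpsilon FunctionalExtensionality Arith.
Require Import Defs.

(** From choice to the maximum principle: below [p], take a maximal antichain of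
    conditions [r] for which some name [t_r] satisfies [r ⊩ θ(t_r)], choose such
    names (Collection confines the candidates to a set), and mix them into one
    name [τ] with [r ⊩ τ = t_r] for all [r] in the antichain.

    Conversely, let [F] be a family of nonempty sets, and let the poset consist of
    pairwise incompatible atoms [X ∈ F] below a largest element [1].  The name
    [Γ = {(X, y̌) : y ∈ X ∈ F}] is forced by [X] to equal [X̌], so
    [1 ⊩ ∃x (x ∈ Γ)].  A name [τ] with [1 ⊩ τ ∈ Γ] has, at each atom [X], a
    unique value [y ∈ X] with [X ⊩ τ = y̌], and these values form a choice
    function. *)

(** * Definability with parameters *)

(** [M] is an arbitrary model of first-order ZF, and its membership may be ill-founded from outside.
    Induction and recursion in Rocq therefore do not reach its sets: every separation, replacement,
    ∈-induction and recursion is carried out in [M] for a predicate definable with parameters, and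
    this side condition shapes the whole development. The epsilon operator of the metatheory enters
    definable terms only where the object is unique in [M], so no choice leaks into the model.
    Forced equality is given by set-sized attempts, so its recursion clause has to be proved before
    it can be used. Mixing needs an antichain because [t_r] may act only below its own [r];
    maximality makes the conditions below members of the antichain dense below [p], and forcing is
    determined on dense sets. In the converse, atoms are used because the density quantifiers
    collapse there: a name for a member of [Γ] has a definite value at an atom. *)

Definition up (f : nat -> nat) (n : nat) : nat :=
  match n with 0 => 0 | S k => S (f k) end.

Fixpoint rename (f : nat -> nat) (phi : formula) : formula :=
  match phi with
  | Mem i j => Mem (f i) (f j)
  | Eq i j => Eq (f i) (f j)
  | Neg psi => Neg (rename f psi)
  | And psi chi => And (rename f psi) (rename f chi)
  | Ex psi => Ex (rename (up f) psi)
  end.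

Lemma sat_rename (M : mem_structure) (phi : formula) :
  forall (f : nat -> nat) (rho : nat -> M),
  sat M rho (rename f phi) <-> sat M (fun n => rho (f n)) phi.
Proof.
  induction phi as [i j|i j|phi IH|phi IH psi IH2|phi IH]; intros f rho; simpl;
    try tauto.
  - now rewrite IH.
  - now rewrite IH, IH2.
  - assert (E : forall x, (fun n => scons x rho (up f n))
                          = scons x (fun n => rho (f n))).
    { intros x; apply functional_extensionality; now intros [|n]. }
    split; intros [x Hx]; exists x.
    + now rewrite <- E, <- IH.
    + now rewrite IH, E.
Qed.

Section Model.

Context {M : mem_structure}.

Definition value (g : nat -> nat + M) (e : nat -> M) (n : nat) : M :=
  match g n with inl i => e i | inr c => c end.

(** [g] tells for each variable of the defining formula which coordinate of the
    environment, or else which parameter, it stands for. *)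
Definition Def (R : (nat -> M) -> Prop) : Prop :=
  exists phi g, forall e, R e <-> sat M (value g e) phi.

(** The graph of the term [u] is definable; its value is coordinate 0. *)
Definition DT (u : (nat -> M) -> M) : Prop :=
  Def (fun e => e 0 = u (fun n => e (S n))).

Lemma Def_ext (R S : (nat -> M) -> Prop) :
  (forall e, R e <-> S e) -> Def R -> Def S.
Proof.
  intros H [phi [g Hg]]; exists phi, g; intros e; now rewrite <- H.
Qed.

Lemma Def_subst (R : (nat -> M) -> Prop) (s : nat -> nat + M) :
  Def R -> Def (fun e => R (value s e)).
Proof.
  intros [phi [g Hg]].
  exists phi, (fun n => match g n with inl i => s i | inr c => inr c end).
  intros e; rewrite Hg.
  replace (value g (value s e)) with
    (value (fun n => match g n with inl i => s i | inr c => inr c end) e); [tauto|].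
  apply functional_extensionality; intros n; unfold value.
  now destruct (g n).
Qed.

Lemma Def_rename (f : nat -> nat) (R : (nat -> M) -> Prop) :
  Def R -> Def (fun e => R (fun n => e (f n))).
Proof. exact (Def_subst R (fun n => inl (f n))). Qed.

Lemma Def_not (R : (nat -> M) -> Prop) : Def R -> Def (fun e => ~ R e).
Proof.
  intros [phi [g Hg]]; exists (Neg phi), g; intros e; simpl; now rewrite Hg.
Qed.

(** The two formulas read their variables through different assignments. These are kept apart by
    moving the variables of one to even and those of the other to odd indices. *)
Lemma Def_and (R T : (nat -> M) -> Prop) :
  Def R -> Def T -> Def (fun e => R e /\ T e).
Proof.
  intros [phi [g Hg]] [psi [h Hh]].
  exists (And (rename (fun n => 2 * n) phi) (rename (fun n => S (2 * n)) psi)).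
  exists (fun k => if Nat.even k then g (Nat.div2 k) else h (Nat.div2 k)).
  intros e; cbn [sat]; rewrite !sat_rename, Hg, Hh; unfold value.
  assert (E1 : forall n, Nat.even (2 * n) = true).
  { intros n; apply Nat.even_spec; now exists n. }
  assert (E2 : forall n, Nat.even (S (2 * n)) = false).
  { intros n; now rewrite Nat.even_succ, <- Nat.negb_even, E1. }
  split; intros [H1 H2]; (split; [revert H1; clear H2|revert H2; clear H1]);
    match goal with |- sat _ ?a _ -> sat _ ?b _ => replace a with b; [tauto|] end;
    apply functional_extensionality; intros n;
    now rewrite ?E1, ?E2, ?Nat.div2_double, ?Nat.div2_succ_double.
Qed.

(** All variables of [phi] that stand for coordinate 0 become the one bound variable; the others are
    shifted past the binder and their coordinates drop by one. *)
Lemma Def_ex (A : M -> (nat -> M) -> Prop) :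
  Def (fun e => A (e 0) (fun n => e (S n))) -> Def (fun e => exists x, A x e).
Proof.
  intros [phi [g Hg]].
  exists (Ex (rename (fun n => match g n with inl 0 => 0 | _ => S n end) phi)).
  exists (fun n => match g n with inl (S i) => inl i | w => w end).
  intros e; cbn [sat].
  assert (E : forall x, A x e <-> sat M (value g (scons x e)) phi).
  { intros x; exact (Hg (scons x e)). }
  split; intros [x Hx]; exists x; revert Hx; rewrite E, sat_rename;
    match goal with |- sat _ ?a _ -> sat _ ?b _ => replace a with b; [tauto|] end;
    apply functional_extensionality; intros n; unfold value;
    destruct (g n) as [[|i]|c] eqn:Hn; simpl; now rewrite ?Hn.
Qed.

Lemma Def_or (R S : (nat -> M) -> Prop) :
  Def R -> Def S -> Def (fun e => R e \/ S e).
Proof.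
  intros HR HS; apply (Def_ext (fun e => ~ (~ R e /\ ~ S e))).
  - intros e; tauto.
  - auto using Def_not, Def_and.
Qed.

Lemma Def_imp (R S : (nat -> M) -> Prop) :
  Def R -> Def S -> Def (fun e => R e -> S e).
Proof.
  intros HR HS; apply (Def_ext (fun e => ~ (R e /\ ~ S e))).
  - intros e; tauto.
  - auto using Def_not, Def_and.
Qed.

Lemma Def_iff (R S : (nat -> M) -> Prop) :
  Def R -> Def S -> Def (fun e => R e <-> S e).
Proof. intros; unfold iff; auto using Def_and, Def_imp. Qed.

Lemma Def_all (A : M -> (nat -> M) -> Prop) :
  Def (fun e => A (e 0) (fun n => e (S n))) -> Def (fun e => forall x, A x e).
Proof.
  intros H; apply (Def_ext (fun e => ~ exists x, ~ A x e)).
  - intros e; split; intros H1.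
    + intros x; apply NNPP; eauto.
    + intros [x Hx]; auto.
  - apply Def_not, (Def_ex (fun x e => ~ A x e)), Def_not, H.
Qed.

Lemma DT_var (i : nat) : DT (fun e => e i).
Proof.
  exists (Eq 0 1), (fun n => match n with 0 => inl 0 | _ => inl (S i) end).
  now simpl.
Qed.

Lemma DT_const (c : M) : DT (fun _ => c).
Proof.
  exists (Eq 0 1), (fun n => match n with 0 => inl 0 | _ => inr c end).
  now simpl.
Qed.

Lemma DT_shift (u : (nat -> M) -> M) : DT u -> DT (fun e => u (fun n => e (S n))).
Proof.
  exact (Def_rename (fun n => match n with 0 => 0 | S k => S (S k) end)
           (fun e => e 0 = u (fun n => e (S n)))).
Qed.

(** The language has no function symbols, so a definable term is substituted by quantifying over its
    value. *)
Lemma Def_let (A : M -> (nat -> M) -> Prop) (u : (nat -> M) -> M) :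
  DT u -> Def (fun e => A (e 0) (fun n => e (S n))) -> Def (fun e => A (u e) e).
Proof.
  intros Hu HA; apply (Def_ext (fun e => exists x, x = u e /\ A x e)).
  - intros e; split; [now intros [x [-> H]]|intros H; now exists (u e)].
  - apply (Def_ex (fun x e => x = u e /\ A x e)), Def_and; assumption.
Qed.

Lemma Def_app1 (A : M -> Prop) (u : (nat -> M) -> M) :
  Def (fun e => A (e 0)) -> DT u -> Def (fun e => A (u e)).
Proof. intros HA Hu; now apply (Def_let (fun x _ => A x)). Qed.

Lemma Def_app2 (A : M -> M -> Prop) (u v : (nat -> M) -> M) :
  Def (fun e => A (e 0) (e 1)) -> DT u -> DT v -> Def (fun e => A (u e) (v e)).
Proof.
  intros HA Hu Hv; apply (Def_let (fun x e => A x (v e))); [assumption|].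
  apply (Def_let (fun y e => A (e 0) y)); [now apply DT_shift|].
  exact (Def_rename (fun n => match n with 0 => 1 | _ => 0 end) _ HA).
Qed.

Lemma Def_app3 (A : M -> M -> M -> Prop) (u v w : (nat -> M) -> M) :
  Def (fun e => A (e 0) (e 1) (e 2)) -> DT u -> DT v -> DT w ->
  Def (fun e => A (u e) (v e) (w e)).
Proof.
  intros HA Hu Hv Hw; apply (Def_let (fun x e => A x (v e) (w e))); [assumption|].
  apply (Def_let (fun y e => A (e 0) y (w (fun n => e (S n)))));
    [now apply DT_shift|].
  apply (Def_let (fun z e => A (e 1) (e 0) z)); [exact (DT_shift _ (DT_shift _ Hw))|].
  exact (Def_rename (fun n => match n with 0 => 2 | 1 => 1 | _ => 0 end) _ HA).
Qed.

Lemma DT_app1 (f : M -> M) (u : (nat -> M) -> M) :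
  DT (fun e => f (e 0)) -> DT u -> DT (fun e => f (u e)).
Proof.
  intros Hf Hu; apply (Def_app2 (fun z x => z = f x)); auto using DT_var, DT_shift.
Qed.

Lemma DT_app2 (f : M -> M -> M) (u v : (nat -> M) -> M) :
  DT (fun e => f (e 0) (e 1)) -> DT u -> DT v -> DT (fun e => f (u e) (v e)).
Proof.
  intros Hf Hu Hv; apply (Def_app3 (fun z x y => z = f x y));
    auto using DT_var, DT_shift.
Qed.

Lemma Def_eq (u v : (nat -> M) -> M) : DT u -> DT v -> Def (fun e => u e = v e).
Proof. intros Hu Hv; apply (Def_app2 (fun x y => x = y)); auto. apply DT_var. Qed.

Lemma Def_mem (u v : (nat -> M) -> M) : DT u -> DT v -> Def (fun e => u e ∈ v e).
Proof.
  intros Hu Hv; apply (Def_app2 (fun x y => x ∈ y)); auto.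
  exists (Mem 0 1), (fun n => inl n); now simpl.
Qed.

(** Comprehension inside a term is applied at a fixed environment, whose coordinates then turn into
    parameters. *)
Lemma Def_section (A : M -> (nat -> M) -> Prop) (e : nat -> M) :
  Def (fun e => A (e 0) (fun n => e (S n))) -> Def (fun e' => A (e' 0) e).
Proof.
  intros HA; exact (Def_subst _
    (fun n => match n with 0 => inl 0 | S k => inr (e k) end) HA).
Qed.

Lemma DT_section (f : M -> (nat -> M) -> M) (e : nat -> M) :
  DT (fun e => f (e 0) (fun n => e (S n))) -> DT (fun e' => f (e' 0) e).
Proof.
  intros HA; exact (Def_subst _
    (fun n => match n with 0 => inl 0 | 1 => inl 1 | S (S k) => inr (e k) end) HA).
Qed.

(** * Sets in a model of ZF *)

Definition transitive (T : M) : Prop := forall x y, x ∈ T -> y ∈ x -> y ∈ T.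

Definition subset (x y : M) : Prop := forall z, z ∈ x -> z ∈ y.

Context (HZF : ZF M).

Lemma ext (x y : M) : (forall z, z ∈ x <-> z ∈ y) -> x = y.
Proof. apply (ZF_extensionality _ HZF). Qed.

Lemma inhabited_model : inhabited M.
Proof. destruct (ZF_infinity _ HZF) as [w _]; exact (inhabits w). Qed.

(** A total description operator of the metatheory; [DT_the] makes its values definable only under
    unique existence. *)
Definition the (A : M -> Prop) : M := epsilon inhabited_model A.

Lemma the_spec (A : M -> Prop) : (exists x, A x) -> A (the A).
Proof. apply epsilon_spec. Qed.

Lemma DT_the (A : M -> (nat -> M) -> Prop) :
  (forall e, exists! x, A x e) ->
  Def (fun e => A (e 0) (fun n => e (S n))) -> DT (fun e => the (fun x => A x e)).
Proof.
  intros Hu HA; unfold DT; revert HA; apply Def_ext; intros e.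
  destruct (Hu (fun n => e (S n))) as [x [Hx Hx']].
  pose proof (the_spec (fun x => A x (fun n => e (S n))) (ex_intro _ x Hx)) as Ht.
  split; intros H.
  - now rewrite <- (Hx' _ H), <- (Hx' _ Ht).
  - now rewrite H.
Qed.

Definition setof (Q : M -> Prop) : M := the (fun b => forall x, x ∈ b <-> Q x).

Lemma in_setof (Q : M -> Prop) (x : M) :
  (exists b, forall x, x ∈ b <-> Q x) -> (x ∈ setof Q <-> Q x).
Proof. intros H; exact (the_spec (fun b => forall x, x ∈ b <-> Q x) H x). Qed.

Lemma DT_setof (Q : M -> (nat -> M) -> Prop) :
  (forall e, exists b, forall x, x ∈ b <-> Q x e) ->
  Def (fun e => Q (e 0) (fun n => e (S n))) -> DT (fun e => setof (fun x => Q x e)).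
Proof.
  intros Hb HQ; apply (DT_the (fun b e => forall x, x ∈ b <-> Q x e)).
  - intros e; destruct (Hb e) as [b H]; exists b; split; [assumption|].
    intros b' H'; apply ext; intros z; now rewrite H, H'.
  - apply (Def_all (fun x e => x ∈ e 0 <-> Q x (fun n => e (S n)))), Def_iff.
    + apply Def_mem; apply DT_var.
    + exact (Def_rename (fun n => match n with 0 => 0 | S k => S (S k) end) _ HQ).
Qed.

Lemma replacement_value (A : M -> M -> Prop) (a : M) :
  Def (fun e => A (e 0) (e 1)) ->
  (forall x, x ∈ a -> exists! y, A x y) ->
  exists b, forall y, y ∈ b <-> exists x, x ∈ a /\ A x y.
Proof.
  intros [phi [g Hg]] Hu.
  (* [A] looks at coordinates 0 and 1 only, so all later ones may be read as [y]. Parameters move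
     past the two variables [x] and [y] into [rho], whose entry [a] is a filler that is never
     read. *)
  pose (f n := match g n with inl 0 => 0 | inl _ => 1 | inr _ => S (S n) end).
  pose (rho n := match g n with inl _ => a | inr c => c end).
  assert (E : forall x y, sat M (scons x (scons y rho)) (rename f phi) <-> A x y).
  { intros x y; rewrite sat_rename, (Hg (scons x (fun _ => y))).
    match goal with |- sat _ ?a _ <-> sat _ ?b _ => replace a with b; [tauto|] end.
    apply functional_extensionality; intros n; unfold value, f, rho.
    destruct (g n) as [[|i]|c] eqn:En; simpl; now rewrite ?En. }
  destruct (ZF_replacement _ HZF (rename f phi) rho a) as [b Hb].
  - intros x Hx; destruct (Hu x Hx) as [y [Hy Hy']]; exists y.
    split; [now apply E|]; intros z Hz; apply Hy', E, Hz.
  - exists b; intros y; rewrite Hb; split; intros [x [Hx Hxy]]; exists x;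
      (split; [assumption|now apply E]).
Qed.

Definition sep (a : M) (C : M -> Prop) : M := setof (fun x => x ∈ a /\ C x).

Lemma sep_exists (a : M) (C : M -> Prop) :
  Def (fun e => C (e 0)) -> exists b, forall x, x ∈ b <-> x ∈ a /\ C x.
Proof.
  intros [phi [g Hg]].
  pose (f n := match g n with inl _ => 0 | inr _ => S n end).
  pose (rho n := match g n with inl _ => a | inr c => c end).
  destruct (ZF_separation _ HZF (rename f phi) rho a) as [b Hb].
  exists b; intros x; rewrite Hb, sat_rename, (Hg (fun _ => x)).
  match goal with |- _ /\ sat _ ?a _ <-> _ /\ sat _ ?b _ => replace a with b; [tauto|] end.
  apply functional_extensionality; intros n; unfold value, f, rho.
  destruct (g n) as [[|i]|c] eqn:En; simpl; now rewrite ?En.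
Qed.

Lemma in_sep (a : M) (C : M -> Prop) (x : M) :
  Def (fun e => C (e 0)) -> (x ∈ sep a C <-> x ∈ a /\ C x).
Proof. intros HC; apply (in_setof (fun x => x ∈ a /\ C x)), sep_exists, HC. Qed.

Lemma DT_sep (u : (nat -> M) -> M) (C : M -> (nat -> M) -> Prop) :
  DT u -> Def (fun e => C (e 0) (fun n => e (S n))) ->
  DT (fun e => sep (u e) (fun x => C x e)).
Proof.
  intros Hu HC; apply (DT_setof (fun x e => x ∈ u e /\ C x e)).
  - intros e; apply sep_exists, Def_section, HC.
  - apply Def_and, HC; apply Def_mem; auto using DT_shift, DT_var.
Qed.

Definition img (a : M) (f : M -> M) : M := setof (fun y => exists x, x ∈ a /\ y = f x).

Lemma img_exists (a : M) (f : M -> M) :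
  DT (fun e => f (e 0)) -> exists b, forall y, y ∈ b <-> exists x, x ∈ a /\ y = f x.
Proof.
  intros Hf; apply (replacement_value (fun x y => y = f x)).
  - exact (Def_rename (fun n => match n with 0 => 1 | _ => 0 end) _ Hf).
  - intros x _; exists (f x); split; [reflexivity|]; now intros y ->.
Qed.

Lemma in_img (a : M) (f : M -> M) (y : M) :
  DT (fun e => f (e 0)) -> (y ∈ img a f <-> exists x, x ∈ a /\ y = f x).
Proof.
  intros Hf; apply (in_setof (fun y => exists x, x ∈ a /\ y = f x)), img_exists, Hf.
Qed.

Lemma DT_img (u : (nat -> M) -> M) (f : M -> (nat -> M) -> M) :
  DT u -> DT (fun e => f (e 0) (fun n => e (S n))) ->
  DT (fun e => img (u e) (fun x => f x e)).
Proof.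
  intros Hu Hf; apply (DT_setof (fun y e => exists x, x ∈ u e /\ y = f x e)).
  - intros e; apply img_exists, DT_section, Hf.
  - apply (Def_ex (fun x e => x ∈ u (fun n => e (S n)) /\ e 0 = f x (fun n => e (S n)))).
    apply Def_and.
    + apply Def_mem; [apply DT_var|]; exact (DT_shift _ (DT_shift _ Hu)).
    + exact (Def_rename (fun n => match n with 0 => 1 | 1 => 0 | k => k end) _ Hf).
Qed.

(* Definability follows the syntax of a predicate, with one lemma for each connective and each
   operation on sets. Opacity keeps the search from unfolding a notion that has its own lemma. *)
Create HintDb dfn.
#[local] Hint Resolve Def_and Def_or Def_not Def_imp Def_iff Def_ex Def_all Def_mem
  Def_eq DT_var DT_const DT_sep DT_img : dfn.
#[local] Hint Constants Opaque : dfn.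

Ltac dfn := intros; auto 200 with dfn nocore.

(** * Basic set operations as definable terms *)

Definition upair (x y : M) : M := setof (fun u => u = x \/ u = y).
Definition union (x : M) : M := setof (fun z => exists y, z ∈ y /\ y ∈ x).
Definition power (x : M) : M := setof (fun y => subset y x).

Lemma in_upair (x y z : M) : z ∈ upair x y <-> z = x \/ z = y.
Proof. apply (in_setof (fun u => u = x \/ u = y)), (ZF_pairing _ HZF). Qed.

Lemma in_union (x z : M) : z ∈ union x <-> exists y, z ∈ y /\ y ∈ x.
Proof. apply (in_setof (fun z => exists y, z ∈ y /\ y ∈ x)), (ZF_union _ HZF). Qed.

Lemma in_power (x y : M) : y ∈ power x <-> subset y x.
Proof. apply (in_setof (fun y => subset y x)), (ZF_power _ HZF). Qed.

Lemma DT_upair (u v : (nat -> M) -> M) :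
  DT u -> DT v -> DT (fun e => upair (u e) (v e)).
Proof.
  apply (DT_app2 upair), (DT_setof (fun z e => z = e 0 \/ z = e 1)); [|dfn].
  intros e; apply (ZF_pairing _ HZF).
Qed.

Lemma DT_union (u : (nat -> M) -> M) : DT u -> DT (fun e => union (u e)).
Proof.
  apply (DT_app1 union), (DT_setof (fun z e => exists y, z ∈ y /\ y ∈ e 0)); [|dfn].
  intros e; apply (ZF_union _ HZF).
Qed.

Lemma Def_subset (u v : (nat -> M) -> M) :
  DT u -> DT v -> Def (fun e => subset (u e) (v e)).
Proof. apply (Def_app2 subset); unfold subset; dfn. Qed.
#[local] Hint Resolve DT_upair DT_union Def_subset : dfn.

Lemma DT_power (u : (nat -> M) -> M) : DT u -> DT (fun e => power (u e)).
Proof.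
  apply (DT_app1 power), (DT_setof (fun z e => subset z (e 0))); [|dfn].
  intros e; apply (ZF_power _ HZF).
Qed.
#[local] Hint Resolve DT_power : dfn.

Definition opair (x y : M) : M := upair (upair x x) (upair x y).
Definition cup (x y : M) : M := union (upair x y).
Definition prod (a b : M) : M := union (img a (fun x => img b (fun y => opair x y))).
Definition empty : M := setof (fun _ => False).

Lemma DT_opair (u v : (nat -> M) -> M) :
  DT u -> DT v -> DT (fun e => opair (u e) (v e)).
Proof. unfold opair; dfn. Qed.
#[local] Hint Resolve DT_opair : dfn.

Lemma DT_prod (u v : (nat -> M) -> M) :
  DT u -> DT v -> DT (fun e => prod (u e) (v e)).
Proof. apply (DT_app2 prod); unfold prod; dfn. Qed.
#[local] Hint Resolve DT_prod : dfn.

Lemma in_empty (x : M) : ~ x ∈ empty.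
Proof.
  intros H; apply (in_setof (fun _ => False)) in H; [exact H|].
  destruct (ZF_infinity _ HZF) as [w [[e [_ He]] _]].
  exists e; intros z; split; [apply He|tauto].
Qed.

Lemma in_cup (x y z : M) : z ∈ cup x y <-> z ∈ x \/ z ∈ y.
Proof.
  unfold cup; rewrite in_union; setoid_rewrite in_upair.
  split; [intros [w [Hw [->| ->]]]|intros [H|H]]; eauto.
Qed.

Lemma in_prod (a b z : M) :
  z ∈ prod a b <-> exists x y, x ∈ a /\ y ∈ b /\ z = opair x y.
Proof.
  unfold prod; rewrite in_union; split.
  - intros [w [Hz Hw]]; rewrite in_img in Hw by dfn; destruct Hw as [x [Hx ->]].
    rewrite in_img in Hz by dfn; destruct Hz as [y [Hy ->]]; eauto.
  - intros [x [y [Hx [Hy ->]]]]; exists (img b (fun y => opair x y)).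
    rewrite !in_img by dfn; split; [exists y|exists x]; auto.
Qed.

Lemma upair_inj (x y x' y' : M) :
  upair x y = upair x' y' -> (x = x' /\ y = y') \/ (x = y' /\ y = x').
Proof.
  intros H.
  assert (E : forall z, (z = x \/ z = y) <-> (z = x' \/ z = y')).
  { intros z; now rewrite <- !in_upair, H. }
  pose proof (proj1 (E x)); pose proof (proj1 (E y)); pose proof (proj2 (E x'));
    pose proof (proj2 (E y')).
  destruct (classic (x = x')); [left|right]; intuition congruence.
Qed.

Lemma opair_inj (x y x' y' : M) : opair x y = opair x' y' -> x = x' /\ y = y'.
Proof.
  intros H; apply upair_inj in H as [[H1 H2]|[H1 H2]];
    apply upair_inj in H1; apply upair_inj in H2; intuition congruence.
Qed.

Lemma in_prod_opair (a b x y : M) : opair x y ∈ prod a b <-> x ∈ a /\ y ∈ b.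
Proof.
  rewrite in_prod; split; [|now intros []; exists x, y].
  intros [x' [y' [Hx [Hy H]]]]; apply opair_inj in H as [-> ->]; auto.
Qed.

Lemma is_upair_upair (x y z : M) : is_upair x y z <-> z = upair x y.
Proof.
  unfold is_upair; split.
  - intros H; apply ext; intros u; now rewrite in_upair.
  - intros ->; apply in_upair.
Qed.

Lemma is_opair_opair (x y z : M) : is_opair x y z <-> z = opair x y.
Proof.
  unfold is_opair; split.
  - intros [a [b H]]; rewrite !is_upair_upair in H; destruct H as [-> [-> H]].
    exact H.
  - intros ->; exists (upair x x), (upair x y); now rewrite !is_upair_upair.
Qed.

Lemma pair_in_opair (x y r : M) : pair_in x y r <-> opair x y ∈ r.
Proof.
  unfold pair_in; setoid_rewrite is_opair_opair.
  split; [intros [z [-> H]]|]; eauto.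
Qed.

Lemma triple_in_opair (x y z r : M) : triple_in x y z r <-> opair x (opair y z) ∈ r.
Proof.
  unfold triple_in; setoid_rewrite is_opair_opair; setoid_rewrite pair_in_opair.
  split; [intros [t [-> H]]|]; eauto.
Qed.

Lemma Def_is_opair (u v w : (nat -> M) -> M) :
  DT u -> DT v -> DT w -> Def (fun e => is_opair (u e) (v e) (w e)).
Proof.
  intros; apply (Def_ext (fun e => w e = opair (u e) (v e))); [|dfn].
  intros; symmetry; apply is_opair_opair.
Qed.

Lemma Def_pair_in (u v w : (nat -> M) -> M) :
  DT u -> DT v -> DT w -> Def (fun e => pair_in (u e) (v e) (w e)).
Proof.
  intros; apply (Def_ext (fun e => opair (u e) (v e) ∈ w e)); [|dfn].
  intros; symmetry; apply pair_in_opair.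
Qed.

Lemma Def_triple_in (u v w x : (nat -> M) -> M) :
  DT u -> DT v -> DT w -> DT x ->
  Def (fun e => triple_in (u e) (v e) (w e) (x e)).
Proof.
  intros; apply (Def_ext (fun e => opair (u e) (opair (v e) (w e)) ∈ x e)); [|dfn].
  intros; symmetry; apply triple_in_opair.
Qed.
#[local] Hint Resolve Def_is_opair Def_pair_in Def_triple_in : dfn.

Lemma Def_transitive (u : (nat -> M) -> M) : DT u -> Def (fun e => transitive (u e)).
Proof. apply (Def_app1 transitive); unfold transitive; dfn. Qed.
#[local] Hint Resolve Def_transitive : dfn.

Lemma mem_asym (x y : M) : x ∈ y -> y ∈ x -> False.
Proof.
  intros Hxy Hyx; destruct (ZF_foundation _ HZF (upair x y)) as [z [Hz H]].
  - exists x; apply in_upair; auto.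
  - apply in_upair in Hz as [-> | ->]; [apply (H y)|apply (H x)];
      rewrite in_upair; auto.
Qed.

(** * Natural numbers of the model, transitive hulls and ∈-induction *)

Definition succ (n : M) : M := cup n (upair n n).

Lemma in_succ (n z : M) : z ∈ succ n <-> z ∈ n \/ z = n.
Proof. unfold succ; rewrite in_cup, in_upair; tauto. Qed.

Lemma DT_cup (u v : (nat -> M) -> M) : DT u -> DT v -> DT (fun e => cup (u e) (v e)).
Proof. unfold cup; dfn. Qed.
#[local] Hint Resolve DT_cup : dfn.

Lemma DT_succ (u : (nat -> M) -> M) : DT u -> DT (fun e => succ (u e)).
Proof. unfold succ; dfn. Qed.
#[local] Hint Resolve DT_succ : dfn.

Lemma succ_inj (m n : M) : succ m = succ n -> m = n.
Proof.
  intros H; assert (Hm : m ∈ succ n) by (rewrite <- H, in_succ; auto).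
  assert (Hn : n ∈ succ m) by (rewrite H, in_succ; auto).
  rewrite in_succ in Hm, Hn; destruct Hm as [Hm|Hm], Hn as [Hn|Hn]; auto.
  destruct (mem_asym _ _ Hm Hn).
Qed.

(** The set given by infinity may be too large; [w] is the part of it that lies in every inductive
    set. Induction is limited to definable [C], for which [sep w C] is itself an inductive set of
    [M]. *)
Lemma omega_exists : exists w : M, empty ∈ w /\
  (forall n, n ∈ w -> succ n ∈ w) /\
  forall C : M -> Prop, Def (fun e => C (e 0)) -> C empty ->
    (forall n, n ∈ w -> C n -> C (succ n)) -> forall n, n ∈ w -> C n.
Proof.
  pose (inductive I := empty ∈ I /\ forall n, n ∈ I -> succ n ∈ I).
  assert (Hi : exists I, inductive I).
  { destruct (ZF_infinity _ HZF) as [w [[e [He1 He]] Hw]]; exists w; split.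
    - replace empty with e; [assumption|]; apply ext; intros z.
      split; intros H; [destruct (He _ H)|destruct (in_empty _ H)].
    - intros n Hn; destruct (Hw n Hn) as [s [Hs Hs']].
      replace (succ n) with s; [assumption|]; apply ext; intros z.
      now rewrite Hs', in_succ. }
  assert (HD : Def (fun e => forall J, inductive J -> e 0 ∈ J)).
  { unfold inductive; dfn. }
  destruct Hi as [I HI].
  pose (w := sep I (fun n => forall J, inductive J -> n ∈ J)).
  assert (Hw : forall n, n ∈ w <-> forall J, inductive J -> n ∈ J).
  { intros n; unfold w; rewrite in_sep by assumption; split; [tauto|auto]. }
  exists w; split; [|split].
  - apply Hw; intros J HJ; apply HJ.
  - intros n; rewrite !Hw; intros Hn J HJ; apply HJ, Hn, HJ.
  - intros C HC C0 CS n Hn.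
    assert (HK : inductive (sep w C)).
    { split; [|intros m Hm]; rewrite in_sep in * by assumption.
      - split; [apply Hw; intros J HJ; apply HJ|assumption].
      - destruct Hm as [Hm Cm]; split; [|auto].
        apply Hw; intros J HJ; apply HJ, Hw; auto. }
    now apply (proj1 (Hw n) Hn), in_sep in HK.
Qed.

(** The stages [x, ∪x, ∪∪x, ...] of the transitive closure; a stage is certified
    by a set [f] of pairs closed under taking predecessors. *)
Definition stages (x f : M) : Prop :=
  forall n A, opair n A ∈ f ->
  (n = empty /\ A = x) \/
  exists m B, n = succ m /\ A = union B /\ opair m B ∈ f.

Definition stage (x n A : M) : Prop := exists f, stages x f /\ opair n A ∈ f.

Lemma Def_stage (u v w : (nat -> M) -> M) :
  DT u -> DT v -> DT w -> Def (fun e => stage (u e) (v e) (w e)).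
Proof. apply (Def_app3 stage); unfold stage, stages; dfn. Qed.
#[local] Hint Resolve Def_stage : dfn.

Lemma stage_zero (x : M) : stage x empty x.
Proof.
  exists (upair (opair empty x) (opair empty x)); split.
  - intros n A H; left; rewrite in_upair in H.
    destruct H as [H|H]; now apply opair_inj in H.
  - rewrite in_upair; auto.
Qed.

Lemma stage_succ (x n A : M) : stage x n A -> stage x (succ n) (union A).
Proof.
  intros [f [Hf HA]].
  exists (cup f (upair (opair (succ n) (union A)) (opair (succ n) (union A)))).
  split; [|rewrite in_cup, in_upair; auto].
  intros m B H; rewrite in_cup, in_upair in H.
  destruct H as [H|H].
  - destruct (Hf _ _ H) as [?|[m' [B' [? [? ?]]]]]; [auto|right; exists m', B'].
    rewrite in_cup; auto.
  - right; exists n, A; rewrite in_cup.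
    assert (E : opair m B = opair (succ n) (union A)) by (destruct H; assumption).
    apply opair_inj in E as [-> ->]; auto.
Qed.

Lemma empty_neq_succ (n : M) : empty <> succ n.
Proof. intros H; apply (in_empty n); rewrite H, in_succ; auto. Qed.

(** The hull is the union of all stages. Replacement along [w] collects them once induction has
    shown that each stage exists and is unique. *)
Lemma transitive_hull (x : M) : exists T, subset x T /\ transitive T.
Proof.
  destruct omega_exists as [w [W0 [WS Wind]]].
  assert (Hex : forall n, n ∈ w -> exists A, stage x n A).
  { apply (Wind (fun n => exists A, stage x n A)); [dfn|exists x; apply stage_zero|].
    intros n _ [A HA]; exists (union A); now apply stage_succ. }
  assert (Huniq : forall n, n ∈ w -> forall A B, stage x n A -> stage x n B -> A = B).
  { apply (Wind (fun n => forall A B, stage x n A -> stage x n B -> A = B)); [dfn| |].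
    - intros A B [f [Hf HA]] [g [Hg HB]].
      destruct (Hf _ _ HA) as [[_ ->]|[m [? [E _]]]]; [|destruct (empty_neq_succ m E)].
      destruct (Hg _ _ HB) as [[_ ->]|[m [? [E _]]]]; [|destruct (empty_neq_succ m E)].
      reflexivity.
    - intros n Hn IH A B [f [Hf HA]] [g [Hg HB]].
      destruct (Hf _ _ HA) as [[E _]|[m [A' [Em [-> HA']]]]];
        [destruct (empty_neq_succ n (eq_sym E))|].
      destruct (Hg _ _ HB) as [[E _]|[k [B' [Ek [-> HB']]]]];
        [destruct (empty_neq_succ n (eq_sym E))|].
      apply succ_inj in Em, Ek; subst m k.
      f_equal; apply IH; [exists f|exists g]; auto. }
  destruct (replacement_value (fun n A => stage x n A) w) as [S HS]; [dfn| |].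
  { intros n Hn; destruct (Hex n Hn) as [A HA]; exists A.
    split; [assumption|]; intros B HB; eauto. }
  exists (union S); split.
  - intros z Hz; apply in_union; exists x; split; [assumption|].
    apply HS; exists empty; auto using stage_zero.
  - intros y z Hy Hz; apply in_union in Hy as [A [Hy HA]].
    apply HS in HA as [n [Hn HA]]; apply in_union; exists (union A).
    split; [apply in_union; eauto|].
    apply HS; exists (succ n); auto using stage_succ.
Qed.

(** Foundation speaks of sets, while the counterexamples to [C] may form a proper class. Cutting
    them down to a transitive set loses nothing: the elements of a minimal counterexample stay in
    that set. *)
Lemma eps_ind (C : M -> Prop) :
  Def (fun e => C (e 0)) ->
  (forall x, (forall y, y ∈ x -> C y) -> C x) -> forall x, C x.
Proof.
  intros HC IH x; destruct (transitive_hull x) as [T [HxT HT]].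
  assert (HB : forall y, y ∈ sep T (fun y => ~ C y) <-> y ∈ T /\ ~ C y).
  { intros y; apply in_sep; dfn. }
  assert (HTC : forall y, y ∈ T -> C y); [|auto].
  intros y Hy; apply NNPP; intros Hn.
  destruct (ZF_foundation _ HZF (sep T (fun y => ~ C y))) as [z [Hz Hmin]].
  - exists y; now apply HB.
  - apply HB in Hz as [Hz1 Hz2]; apply Hz2, IH; intros u Hu; apply NNPP; intros Hn'.
    apply (Hmin u); split; [apply HB|]; eauto.
Qed.

(** * Recursion on membership *)

Section Recursion.

Context (G : M -> M) (HG : DT (fun e => G (e 0))).

(** The image of [y] under the relation [f]; both coordinates of a pair in [f] lie in [∪∪f], which
    bounds the separation. *)
Definition tail (f y : M) : M :=
  sep (union (union f)) (fun u => exists y', y' ∈ y /\ opair y' u ∈ f).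

Lemma in_tail (f y u : M) : u ∈ tail f y <-> exists y', y' ∈ y /\ opair y' u ∈ f.
Proof.
  unfold tail; rewrite in_sep by dfn; split; [tauto|].
  intros H; split; [|assumption]; destruct H as [y' [_ H]].
  apply in_union; exists (upair y' u); split; [apply in_upair; auto|].
  apply in_union; exists (opair y' u); split; [apply in_upair; auto|assumption].
Qed.

(** A partial solution of the recursion. Functionality of [f] is not demanded; it follows from
    [rec_unique]. *)
Definition rec_derivation (f : M) : Prop :=
  forall y u, opair y u ∈ f ->
  (forall y', y' ∈ y -> exists u', opair y' u' ∈ f) /\ u = G (tail f y).

Definition rec_rel (x v : M) : Prop := exists f, rec_derivation f /\ opair x v ∈ f.

Lemma Def_rec_rel (u v : (nat -> M) -> M) :
  DT u -> DT v -> Def (fun e => rec_rel (u e) (v e)).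
Proof.
  pose proof (fun u => DT_app1 G u HG) as HG'.
  apply (Def_app2 rec_rel); unfold rec_rel, rec_derivation, tail; dfn.
Qed.
#[local] Hint Resolve Def_rec_rel : dfn.

Lemma rec_unique (x : M) : forall v w, rec_rel x v -> rec_rel x w -> v = w.
Proof.
  revert x; apply (eps_ind
    (fun x => forall v w, rec_rel x v -> rec_rel x w -> v = w)); [dfn|].
  intros x IH.
  assert (Half : forall f g v w, rec_derivation f -> opair x v ∈ f ->
    rec_derivation g -> opair x w ∈ g -> subset (tail f x) (tail g x)).
  { intros f g v w Hf Hv Hg Hw u Hu; apply in_tail in Hu as [y [Hy Hu]].
    apply in_tail; exists y; split; [assumption|].
    destruct (proj1 (Hg _ _ Hw) y Hy) as [u' Hu'].
    replace u with u'; [assumption|].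
    apply (IH y Hy); [exists g|exists f]; auto. }
  intros v w [f [Hf Hv]] [g [Hg Hw]].
  rewrite (proj2 (Hf _ _ Hv)), (proj2 (Hg _ _ Hw)); f_equal.
  apply ext; split; eapply Half; eassumption.
Qed.

Lemma rec_exists (x : M) : exists v, rec_rel x v.
Proof.
  revert x; apply (eps_ind (fun x => exists v, rec_rel x v)); [dfn|]; intros x IH.
  destruct (transitive_hull x) as [T [HxT HT]].
  (* Arguing by contradiction guarantees that [x] has no value yet. Adding the pair [(x, v)] then
     cannot change the image of any set whose elements all have values. *)
  apply NNPP; intros Hno.
  destruct (replacement_value (fun y z => exists v, rec_rel y v /\ z = opair y v)
    (sep T (fun y => exists v, rec_rel y v))) as [f Hf]; [dfn| |].
  { intros y Hy; rewrite in_sep in Hy by dfn; destruct Hy as [_ [v Hv]].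
    exists (opair y v); split; [eauto|].
    intros z [v' [Hv' ->]]; now rewrite (rec_unique _ _ _ Hv Hv'). }
  assert (Hf' : forall y v, opair y v ∈ f <-> y ∈ T /\ rec_rel y v).
  { intros y v; rewrite Hf; setoid_rewrite in_sep; [|dfn]; split.
    - intros [y' [[Hy' _] [v' [Hv' E]]]]; apply opair_inj in E as [-> ->]; auto.
    - intros [Hy Hv]; exists y; eauto 6. }
  pose (v := G (tail f x)).
  apply Hno; exists v.
  exists (cup f (upair (opair x v) (opair x v))).
  assert (Hin : forall y u, opair y u ∈ cup f (upair (opair x v) (opair x v)) <->
    (y ∈ T /\ rec_rel y u) \/ (y = x /\ u = v)).
  { intros y u; rewrite in_cup, in_upair, Hf'; split.
    - intros [H|[H|H]]; auto; apply opair_inj in H; auto.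
    - intros [H|[-> ->]]; auto. }
  split; [|apply Hin; auto].
  assert (Htail : forall y, (forall y', y' ∈ y -> exists u, rec_rel y' u) ->
    tail (cup f (upair (opair x v) (opair x v))) y = tail f y).
  { intros y Hy; apply ext; intros u; rewrite !in_tail.
    setoid_rewrite Hin; setoid_rewrite Hf'; split.
    - intros [y' [Hy' [H|[-> _]]]]; [eauto|destruct (Hno (Hy _ Hy'))].
    - intros [y' [Hy' H]]; eauto. }
  intros y u Hyu; apply Hin in Hyu as [[HyT Hyu]|[-> ->]].
  - destruct Hyu as [g [Hg Hyu]]; destruct (Hg _ _ Hyu) as [Hpred Hu].
    assert (Hpred' : forall y', y' ∈ y -> exists u', rec_rel y' u' /\ opair y' u' ∈ g).
    { intros y' Hy'; destruct (Hpred y' Hy') as [u' Hu']; exists u'.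
      split; [exists g|]; auto. }
    split.
    + intros y' Hy'; destruct (Hpred' y' Hy') as [u' [Hu' _]]; exists u'.
      apply Hin; eauto.
    + rewrite Htail by (intros y' Hy'; destruct (Hpred' y' Hy') as [u' []]; eauto).
      rewrite Hu; f_equal; apply ext; intros z; rewrite !in_tail; setoid_rewrite Hf'.
      split; intros [y' [Hy' H]]; exists y'; split; auto.
      * split; [eauto|]; exists g; auto.
      * destruct (Hpred' y' Hy') as [u' [Hu' Hg']].
        now rewrite (rec_unique y' z u').
  - split; [|now rewrite Htail].
    intros y' Hy'; destruct (IH y' Hy') as [u Hu]; exists u; apply Hin; auto.
Qed.

Definition rec (x : M) : M := the (rec_rel x).

Lemma rec_rel_rec (x : M) : rec_rel x (rec x).
Proof. exact (the_spec _ (rec_exists x)). Qed.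

Lemma DT_rec (u : (nat -> M) -> M) : DT u -> DT (fun e => rec (u e)).
Proof.
  apply (DT_app1 rec), (DT_the (fun v e => rec_rel (e 0) v)); [|dfn].
  intros e; exists (rec (e 0)); split; [apply rec_rel_rec|].
  intros v Hv; eapply rec_unique; [apply rec_rel_rec|assumption].
Qed.
#[local] Hint Resolve DT_rec : dfn.

Lemma rec_eq (x : M) : rec x = G (img x rec).
Proof.
  destruct (rec_rel_rec x) as [f [Hf Hx]]; destruct (Hf _ _ Hx) as [Hpred Hu].
  rewrite Hu; f_equal; apply ext; intros z; rewrite in_tail, in_img by dfn.
  split; intros [y [Hy H]]; exists y; split; auto.
  - apply (rec_unique y); [exists f; auto|apply rec_rel_rec].
  - destruct (Hpred y Hy) as [u Hyu].
    rewrite H, (rec_unique y (rec y) u); [assumption|apply rec_rel_rec|exists f; auto].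
Qed.

End Recursion.

(** * The cumulative hierarchy, Collection and induction on rank *)

Lemma DT_union_powers : DT (fun e => union (img (e 0) power)).
Proof. dfn. Qed.

(** [V x] is the level of the cumulative hierarchy indexed by the rank of [x]. *)
Definition V : M -> M := rec (fun s => union (img s power)).

Lemma DT_V (u : (nat -> M) -> M) : DT u -> DT (fun e => V (u e)).
Proof. exact (DT_rec _ DT_union_powers u). Qed.
#[local] Hint Resolve DT_V : dfn.

Lemma in_V (x z : M) : z ∈ V x <-> exists y, y ∈ x /\ subset z (V y).
Proof.
  unfold V at 1; rewrite (rec_eq _ DT_union_powers), in_union; fold V; split.
  - intros [w [Hz Hw]]; rewrite in_img in Hw by dfn; destruct Hw as [v [Hv ->]].
    rewrite in_img in Hv by dfn; destruct Hv as [y [Hy ->]].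
    exists y; now rewrite <- in_power.
  - intros [y [Hy Hz]]; exists (power (V y)); rewrite in_power, in_img by dfn.
    split; [assumption|]; exists (V y); rewrite in_img by dfn; eauto.
Qed.

Lemma V_transitive (x : M) : transitive (V x).
Proof.
  revert x; apply (eps_ind (fun x => transitive (V x))); [dfn|].
  intros x IH z w Hz Hw; apply in_V in Hz as [y [Hy Hz]]; apply in_V.
  exists y; split; [assumption|]; intros u Hu; eapply IH; eauto.
Qed.

Lemma V_subset (x z w : M) : z ∈ V x -> subset w z -> w ∈ V x.
Proof.
  rewrite !in_V; intros [y [Hy Hz]] Hw; exists y; split; [assumption|].
  intros u Hu; auto.
Qed.

Lemma subset_V (x : M) : subset x (V x).
Proof.
  revert x; apply (eps_ind (fun x => subset x (V x))); [dfn|].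
  intros x IH y Hy; apply in_V; eauto.
Qed.

(** Levels play the role of ordinals, and this is their linear order. By double ∈-induction: if
    [V x ∉ V y], then [V y' ∈ V x] for every [y' ∈ y], and so [V y ⊆ V x]. *)
Lemma V_linear (x : M) : forall y, subset (V y) (V x) \/ V x ∈ V y.
Proof.
  revert x; apply (eps_ind (fun x => forall y, subset (V y) (V x) \/ V x ∈ V y));
    [dfn|]; intros x IHx.
  apply (eps_ind (fun y => subset (V y) (V x) \/ V x ∈ V y)); [dfn|]; intros y IHy.
  destruct (classic (V x ∈ V y)) as [H|Hxy]; [now right|left].
  assert (Hlt : forall y', y' ∈ y -> V y' ∈ V x).
  { intros y' Hy'; destruct (IHy y' Hy') as [H|H].
    - assert (Hn : ~ subset (V x) (V y')) by (intros H'; apply Hxy, in_V; eauto).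
      apply not_all_ex_not in Hn as [z Hn]; apply imply_to_and in Hn as [Hz Hn].
      apply in_V in Hz as [x' [Hx' Hz]].
      destruct (IHx x' Hx' y') as [H'|H']; [apply in_V; eauto|].
      destruct Hn; exact (V_subset _ _ _ H' Hz).
    - destruct Hxy; apply in_V; exists y'; split; [assumption|].
      intros z Hz; exact (V_transitive _ _ _ H Hz). }
  intros z Hz; apply in_V in Hz as [y' [Hy' Hz]].
  exact (V_subset _ _ _ (Hlt y' Hy') Hz).
Qed.

Lemma V_total (x y : M) : subset (V x) (V y) \/ subset (V y) (V x).
Proof.
  destruct (V_linear y x) as [H|H]; [now left|right].
  intros z Hz; exact (V_transitive _ _ _ H Hz).
Qed.

(** Scott's trick: a witness cannot be selected without choice, but the least level of a witness is
    determined by [x], so replacement applies to levels. *)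
Lemma collection (A : M -> M -> Prop) (a : M) :
  Def (fun e => A (e 0) (e 1)) ->
  exists b, forall x, x ∈ a -> (exists y, A x y) -> exists y, y ∈ b /\ A x y.
Proof.
  intros HA.
  assert (HA' : forall u v, DT u -> DT v -> Def (fun e => A (u e) (v e))).
  { intros u v; now apply Def_app2. }
  pose (L x v := (exists y, A x y /\ v = V y) /\ forall y, A x y -> ~ V y ∈ v).
  assert (HL : forall x y, A x y -> exists v, L x v).
  { intros x y Hy; apply NNPP; intros Hn.
    assert (H : forall v, ~ exists y, A x y /\ v = V y); [|apply (H (V y)); eauto].
    apply (eps_ind (fun v => ~ exists y, A x y /\ v = V y)); [dfn|].
    intros v IH H; apply Hn; exists v; split; [assumption|].
    intros y' Hy' Hv; apply (IH _ Hv); eauto. }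
  destruct (replacement_value L (sep a (fun x => exists y, A x y))) as [b Hb].
  - unfold L; dfn.
  - intros x Hx; rewrite in_sep in Hx by dfn; destruct Hx as [_ [y Hy]].
    destruct (HL x y Hy) as [v Hv]; exists v; split; [assumption|].
    intros w Hw; destruct Hv as [[y1 [Hy1 ->]] Hv], Hw as [[y2 [Hy2 ->]] Hw].
    (* Two minimal levels, neither an element of the other, include each other by comparability. *)
    destruct (V_linear y1 y2) as [H1|H1]; [|destruct (Hw y1 Hy1 H1)].
    destruct (V_linear y2 y1) as [H2|H2]; [|destruct (Hv y2 Hy2 H2)].
    apply ext; split; auto.
  - exists (union (img b power)); intros x Hx [y Hy].
    destruct (HL x y Hy) as [v Hv].
    assert (Hvb : v ∈ b).
    { apply Hb; exists x; split; [apply in_sep; [dfn|eauto]|assumption]. }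
    destruct Hv as [[z [Hz ->]] _]; exists z; split; [|assumption].
    apply in_union; exists (power (V z)).
    rewrite in_power, in_img by dfn; split; [apply subset_V|eauto].
Qed.

(** Induction on the maximum of the ranks of three sets. *)
Lemma level_ind3 (C : M -> M -> M -> Prop) :
  Def (fun e => C (e 0) (e 1) (e 2)) ->
  (forall a b c U, transitive U -> subset a U -> subset b U -> subset c U ->
    (forall a' b' c', a' ∈ U -> b' ∈ U -> c' ∈ U -> C a' b' c') -> C a b c) ->
  forall a b c, C a b c.
Proof.
  intros HC IH.
  assert (HC' : forall u v w, DT u -> DT v -> DT w ->
    Def (fun e => C (u e) (v e) (w e))).
  { intros u v w; now apply Def_app3. }
  assert (H : forall x a b c, a ∈ V x -> b ∈ V x -> c ∈ V x -> C a b c).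
  { apply (eps_ind (fun x =>
      forall a b c, a ∈ V x -> b ∈ V x -> c ∈ V x -> C a b c)); [dfn|].
    intros x IHx a b c Ha Hb Hc.
    assert (Hmax : forall a b, a ∈ V x -> b ∈ V x ->
      exists y, y ∈ x /\ subset a (V y) /\ subset b (V y)).
    { intros a' b' Ha' Hb'; apply in_V in Ha' as [y [Hy Ha']].
      apply in_V in Hb' as [z [Hz Hb']]; unfold subset in *.
      destruct (V_total y z); [exists z|exists y]; auto 6. }
    destruct (Hmax a b Ha Hb) as [y [Hy [Hay Hby]]].
    (* [V y] stands in for both [a] and [b], so that a bound for two sets yields one for three. *)
    destruct (Hmax (V y) c) as [z [Hz [Hyz Hcz]]].
    - apply in_V; exists y; split; [assumption|now intros ?].
    - assumption.
    - apply (IH a b c (V z)); unfold subset in *; auto using V_transitive.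
      intros; apply (IHx z); auto. }
  intros a b c; pose (U := V (cup (upair a b) (upair c c))).
  assert (HU : forall z, z = a \/ z = b \/ z = c -> z ∈ U).
  { intros z Hz; apply subset_V; rewrite in_cup, !in_upair; tauto. }
  apply (H (cup (upair a b) (upair c c))); apply HU; auto.
Qed.

Lemma level_ind2 (C : M -> M -> Prop) :
  Def (fun e => C (e 0) (e 1)) ->
  (forall a b U, transitive U -> subset a U -> subset b U ->
    (forall a' b', a' ∈ U -> b' ∈ U -> C a' b') -> C a b) ->
  forall a b, C a b.
Proof.
  intros HC IH a b; refine (level_ind3 (fun a b _ => C a b) HC _ a b a).
  intros a' b' _ U HU Ha Hb _ H; apply (IH a' b' U); auto.
  intros x y Hx Hy; now apply (H x y x).
Qed.

(** * Consequences of choice: definable selectors and maximal antichains *)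

Lemma choice_function (X : M) : axiom_of_choice M ->
  exists g : M -> M, DT (fun e => g (e 0)) /\
    forall A, subset A X -> (exists y, y ∈ A) -> g A ∈ A.
Proof.
  intros HAC.
  assert (HF : forall A, A ∈ sep (power X) (fun A => exists y, y ∈ A) <->
    subset A X /\ exists y, y ∈ A).
  { intros A; now rewrite in_sep, in_power by dfn. }
  destruct (HAC (sep (power X) (fun A => exists y, y ∈ A))) as [f [[_ Hf] Hmem]].
  { intros x Hx; now apply HF in Hx. }
  (* The inner set is the singleton of the value of [f] at [A], and its union is that value. This
     gives a total definable term, which may occur in later comprehensions. *)
  exists (fun A => union (sep (union (union f)) (fun y => pair_in A y f))).
  split; [dfn|]; intros A HAX HA.
  destruct (Hmem A) as [y [Hy HyA]]; [now apply HF|].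
  destruct (Hf A) as [y' [_ Huniq]]; [now apply HF|].
  replace (union _) with y; [assumption|].
  assert (Hsep : forall z, z ∈ sep (union (union f)) (fun y => pair_in A y f) <-> z = y).
  { intros z; rewrite in_sep by dfn; split.
    - intros [_ Hz]; now rewrite <- (Huniq z Hz), <- (Huniq y Hy).
    - intros ->; split; [|assumption]; rewrite pair_in_opair in Hy.
      apply in_union; exists (upair A y); split; [apply in_upair; auto|].
      apply in_union; exists (opair A y); split; [apply in_upair; auto|assumption]. }
  apply ext; intros u; rewrite in_union; split.
  - intros Hu; exists y; split; [assumption|now apply Hsep].
  - intros [z [Hu Hz]]; apply Hsep in Hz as ->; assumption.
Qed.

(** Zermelo's argument: the least family closed under unions of chains and under
    adding a chosen further element is itself a chain, and its union is maximal. *)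
Lemma maximal_antichain (D : M) (K : M -> M -> Prop) :
  axiom_of_choice M -> Def (fun e => K (e 0) (e 1)) ->
  (forall d, d ∈ D -> K d d) -> (forall x y, K x y -> K y x) ->
  exists A, subset A D /\ (forall x y, x ∈ A -> y ∈ A -> K x y -> x = y) /\
    forall d, d ∈ D -> exists x, x ∈ A /\ K d x.
Proof.
  intros HAC HK Krefl Ksym.
  assert (HK' : forall u v, DT u -> DT v -> Def (fun e => K (u e) (v e))).
  { intros u v; now apply Def_app2. }
  destruct (choice_function D HAC) as [g [Hg Hchoice]].
  pose proof (fun u => DT_app1 g u Hg) as Hg'.
  pose (free A := sep D (fun d => forall x, x ∈ A -> ~ K d x)).
  assert (Hfree : forall A d, d ∈ free A <-> d ∈ D /\ forall x, x ∈ A -> ~ K d x).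
  { intros A d; unfold free; now rewrite in_sep by dfn. }
  (* Separating inside [free A] makes [h A = A] when no candidate is left, whatever the value of [g]
     there. *)
  pose (h A := cup A (sep (free A) (fun z => z = g (free A)))).
  assert (Dfree : forall u, DT u -> DT (fun e => free (u e)))
    by (intros u; apply (DT_app1 free); unfold free; dfn).
  assert (Hh : forall A z, z ∈ h A <-> z ∈ A \/ (z ∈ free A /\ z = g (free A))).
  { intros A z; unfold h; now rewrite in_cup, in_sep by dfn. }
  assert (Dh : forall u, DT u -> DT (fun e => h (u e)))
    by (intros u; apply (DT_app1 h); unfold h; dfn).
  clearbody free h.
  pose (chain S := forall A B, A ∈ S -> B ∈ S -> subset A B \/ subset B A).
  pose (closed C := (forall A, A ∈ C -> h A ∈ C) /\
    forall S, subset S C -> chain S -> union S ∈ C).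
  pose (T := sep (power D) (fun A => forall C, closed C -> A ∈ C)).
  assert (HD : closed (power D)).
  { split.
    - intros A; rewrite !in_power; intros HA z Hz.
      apply Hh in Hz as [Hz|[Hz _]]; [auto|now apply Hfree in Hz].
    - intros S HS _; apply in_power; intros z Hz; apply in_union in Hz as [A [Hz HA]].
      apply HS, in_power in HA; auto. }
  assert (HT : forall A, A ∈ T <-> forall C, closed C -> A ∈ C).
  { intros A; unfold T; rewrite in_sep by (unfold closed, chain; dfn).
    split; [tauto|auto]. }
  assert (HTc : closed T).
  { split.
    - intros A HA; apply HT; intros C HC; apply HC; now apply HT.
    - intros S HS Hchain; apply HT; intros C HC; apply HC; [|assumption].
      intros A HA; apply HT; auto. }
  assert (Tind : forall Q : M -> Prop, Def (fun e => Q (e 0)) ->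
    (forall A, A ∈ T -> Q A -> Q (h A)) ->
    (forall S, chain S -> (forall A, A ∈ S -> A ∈ T /\ Q A) -> Q (union S)) ->
    forall A, A ∈ T -> Q A).
  { intros Q HQ Hstep Hunion A HA.
    assert (HTQ : forall A, A ∈ sep T Q <-> A ∈ T /\ Q A)
      by (intros; now apply in_sep).
    apply HTQ, (proj1 (HT A) HA); split.
    - intros B HB; apply HTQ in HB as [HB1 HB2]; apply HTQ; split; [|auto].
      now apply HTc.
    - intros S HS Hchain; apply HTQ; split.
      + apply HTc; [|assumption]; intros B HB; now apply HTQ, HS.
      + apply Hunion; [assumption|]; intros B HB; now apply HTQ, HS. }
  assert (Hsucc : forall C, C ∈ T -> (forall A, A ∈ T -> subset A C \/ subset C A) ->
    forall A, A ∈ T -> subset A C \/ subset (h C) A).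
  { intros C HC Hcomp; apply (Tind (fun A => subset A C \/ subset (h C) A)); [dfn| |].
    - intros A HA [HAC'|HCA].
      + destruct (Hcomp (h A)) as [H|H]; [now apply HTc|now left|].
        destruct (classic (subset C A)) as [HCA|HCA].
        * right; replace C with A; [now intros z|]; apply ext; split; auto.
        (* Some [z ∈ C] outside [A] lies in [h A], so it is the one added element; together with
           [A ⊆ C] this puts all of [h A] inside [C]. *)
        * left; apply not_all_ex_not in HCA as [z Hz].
          apply imply_to_and in Hz as [HzC HzA]; intros w Hw.
          apply Hh in Hw as [Hw|[_ Hw]]; [auto|].
          destruct (proj1 (Hh A z) (H z HzC)) as [?|[_ Hz]]; [contradiction|].
          now rewrite Hw, <- Hz.
      + right; intros z Hz; apply Hh; auto.
    - intros S _ HS.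
      destruct (classic (exists A, A ∈ S /\ subset (h C) A)) as [[A [HA H]]|H].
      + right; intros z Hz; apply in_union; eauto.
      + left; intros z Hz; apply in_union in Hz as [A [Hz HA]].
        destruct (proj2 (HS A HA)) as [H'|H']; [auto|destruct H; eauto]. }
  assert (Hchain : forall C, C ∈ T -> forall A, A ∈ T -> subset A C \/ subset C A).
  { apply (Tind (fun C => forall A, A ∈ T -> subset A C \/ subset C A)); [dfn| |].
    - intros C HC IH A HA; destruct (Hsucc C HC IH A HA) as [H|H]; [left|now right].
      intros z Hz; apply Hh; auto.
    - intros S _ HS A HA.
      destruct (classic (exists C, C ∈ S /\ subset A C)) as [[C [HC H]]|H].
      + left; intros z Hz; apply in_union; eauto.
      + right; intros z Hz; apply in_union in Hz as [C [Hz HC]].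
        destruct (proj2 (HS C HC) A HA) as [H'|H']; [destruct H; eauto|auto]. }
  assert (HU : union T ∈ T).
  { apply HTc; [now intros A|]; intros A B HA HB; now apply Hchain. }
  exists (union T); split; [|split].
  - apply in_power, (proj1 (HT _) HU), HD.
  - apply (Tind (fun A => forall x y, x ∈ A -> y ∈ A -> K x y -> x = y)); [dfn| | |].
    + intros A _ IH x y Hx Hy Hxy.
      apply Hh in Hx as [Hx|[Hx Ex]]; apply Hh in Hy as [Hy|[Hy Ey]]; auto.
      * apply Hfree in Hy as [_ Hy]; destruct (Hy x Hx); auto.
      * apply Hfree in Hx as [_ Hx]; destruct (Hx y Hy); auto.
      * congruence.
    + intros S HS IH x y Hx Hy Hxy; apply in_union in Hx as [A [Hx HA]].
      apply in_union in Hy as [B [Hy HB]].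
      destruct (HS A B HA HB) as [H|H]; [apply (IH B HB)|apply (IH A HA)]; auto.
    + assumption.
  - intros d Hd; apply NNPP; intros Hn.
    assert (Hf : g (free (union T)) ∈ free (union T)).
    { apply Hchoice; [intros z Hz; now apply Hfree in Hz|].
      exists d; apply Hfree; split; [assumption|]; eauto. }
    (* [h (union T)] belongs to [T], so the added element already lies in [union T]. As a free
       element it would be unrelated to itself. *)
    assert (Hin : g (free (union T)) ∈ union T).
    { apply in_union; exists (h (union T)); split; [apply Hh; auto|now apply HTc]. }
    apply Hfree in Hf as [HfD Hf]; exact (Hf _ Hin (Krefl _ HfD)).
Qed.

(** * Forcing *)

Section Forcing.

Context (P le : M).

Notation "q ⊴ p" := (stronger P le q p) (at level 70, no associativity).
Notation feq := (forces_eq P le).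
Notation fmem := (forces_mem P le).

(** * Names, and the recursion for forced equality *)

Definition in_dom (c b : M) : Prop := exists s, pair_in s c b.

Lemma Def_stronger (u v : (nat -> M) -> M) :
  DT u -> DT v -> Def (fun e => u e ⊴ v e).
Proof. unfold stronger; dfn. Qed.

Lemma Def_name_closed (u : (nat -> M) -> M) :
  DT u -> Def (fun e => name_closed P (u e)).
Proof. apply (Def_app1 (name_closed P)); unfold name_closed; dfn. Qed.
#[local] Hint Resolve Def_stronger Def_name_closed : dfn.

Lemma Def_is_name (u : (nat -> M) -> M) : DT u -> Def (fun e => is_name P (u e)).
Proof. apply (Def_app1 (is_name P)); unfold is_name; dfn. Qed.

Lemma Def_eq_attempt (u v : (nat -> M) -> M) :
  DT u -> DT v -> Def (fun e => eq_attempt P le (u e) (v e)).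
Proof.
  apply (Def_app2 (eq_attempt P le)); unfold eq_attempt, eq_clause, mem_clause; dfn.
Qed.
#[local] Hint Resolve Def_is_name Def_eq_attempt : dfn.

Lemma Def_forces_eq (u v w : (nat -> M) -> M) :
  DT u -> DT v -> DT w -> Def (fun e => feq (u e) (v e) (w e)).
Proof. apply (Def_app3 feq); unfold forces_eq; dfn. Qed.
#[local] Hint Resolve Def_forces_eq : dfn.

Lemma Def_forces_mem (u v w : (nat -> M) -> M) :
  DT u -> DT v -> DT w -> Def (fun e => fmem (u e) (v e) (w e)).
Proof. apply (Def_app3 fmem); unfold forces_mem, mem_clause; dfn. Qed.
#[local] Hint Resolve Def_forces_mem : dfn.

Lemma name_closed_dom (T s c b : M) :
  name_closed P T -> b ∈ T -> pair_in s c b -> s ∈ P /\ c ∈ T.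
Proof.
  intros HT Hb [z [Hz Hzb]]; destruct (HT b z Hb Hzb) as [p [t [Hp [Ht Hz']]]].
  rewrite is_opair_opair in *; subst z; apply opair_inj in Hz' as [-> ->]; auto.
Qed.

Lemma in_dom_closed (T c b : M) : name_closed P T -> b ∈ T -> in_dom c b -> c ∈ T.
Proof. intros HT Hb [s Hs]; now apply (name_closed_dom T s c b). Qed.

Lemma is_name_pair (s c b : M) : is_name P b -> pair_in s c b -> s ∈ P /\ is_name P c.
Proof.
  intros [T [Hb HT]] Hs; destruct (name_closed_dom T s c b HT Hb Hs).
  split; [|exists T]; auto.
Qed.

Lemma is_name_dom (c b : M) : is_name P b -> in_dom c b -> is_name P c.
Proof. intros Hb [s Hs]; now apply (is_name_pair s c b). Qed.

Lemma transitive_dom (U c b : M) : transitive U -> subset b U -> in_dom c b -> c ∈ U.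
Proof.
  intros HU Hb [s Hs]; rewrite pair_in_opair in Hs.
  apply (HU (upair s c)); [|apply in_upair; auto].
  apply (HU (opair s c)); [auto|apply in_upair; auto].
Qed.

Lemma transitive_subset (U x : M) : transitive U -> x ∈ U -> subset x U.
Proof. intros HU Hx y Hy; eauto. Qed.

(** The names occurring in [x] may come with different closed sets. All names in a transitive hull
    of [x], together with [x], form a single one, so none has to be chosen. *)
Lemma is_name_intro (x : M) :
  (forall z, z ∈ x -> exists p s, p ∈ P /\ is_name P s /\ z = opair p s) ->
  is_name P x.
Proof.
  intros Hx; destruct (transitive_hull x) as [U [HxU HU]].
  pose (T := cup (sep U (fun y => is_name P y)) (upair x x)).
  assert (HT : forall y, y ∈ T <-> (y ∈ U /\ is_name P y) \/ y = x).
  { intros y; unfold T; rewrite in_cup, in_upair, in_sep by dfn; tauto. }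
  exists T; split; [apply HT; auto|].
  intros y z Hy Hz; setoid_rewrite is_opair_opair; setoid_rewrite HT.
  assert (H : subset y U /\ exists p s, p ∈ P /\ is_name P s /\ z = opair p s).
  { apply HT in Hy as [[Hy [T' [HyT HT']]]| ->]; [|auto].
    split; [now apply transitive_subset|].
    destruct (HT' y z HyT Hz) as [p [s [Hp [Hs Hps]]]].
    apply is_opair_opair in Hps; exists p, s; repeat split; auto; exists T'; auto. }
  destruct H as [Hy' [p [s [Hp [Hs ->]]]]]; exists p, s; repeat split; auto; left.
  split; [|assumption]; apply (transitive_dom U s y); auto.
  exists p; now apply pair_in_opair.
Qed.

Lemma mem_clause_congr (f g : M -> M -> M -> Prop) (p a b : M) :
  (forall r d, r ∈ P -> in_dom d b -> (f r a d <-> g r a d)) ->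
  (mem_clause P le f p a b <-> mem_clause P le g p a b).
Proof.
  intros H; split; intros Hp q Hq; destruct (Hp q Hq) as [r [Hr [s [c [Hc [Hs Hf]]]]]];
    exists r; (split; [assumption|]); exists s, c; repeat split; try apply Hs; auto;
    apply (H r c); auto; try apply Hs; exists s; assumption.
Qed.

(** The clause consults its candidate only at names from [dom a ∪ dom b]; this locality is what
    makes it a recursion. *)
Lemma eq_clause_congr (f g : M -> M -> M -> Prop) (p a b : M) :
  (forall r c d, r ∈ P -> in_dom c a \/ in_dom c b -> in_dom d a \/ in_dom d b ->
    (f r c d <-> g r c d)) ->
  (eq_clause P le f p a b <-> eq_clause P le g p a b).
Proof.
  intros H; unfold eq_clause.
  assert (E : forall c, (exists s, pair_in s c a \/ pair_in s c b) -> forall q,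
    (mem_clause P le f q c a <-> mem_clause P le g q c a) /\
    (mem_clause P le f q c b <-> mem_clause P le g q c b)).
  { intros c [s Hc] q.
    assert (Hc' : in_dom c a \/ in_dom c b)
      by (destruct Hc; [left|right]; exists s; assumption).
    split; apply mem_clause_congr; intros r d Hr Hd; apply H; auto. }
  split; intros Hp c Hc q Hq; destruct (E c Hc q) as [E1 E2];
    specialize (Hp c Hc q Hq); tauto.
Qed.

(** Both names of a recursive call may come from the same one of [a] and [b], so the induction is on
    the larger of the two ranks. *)
Lemma attempts_agree (a b : M) : forall T E T' E' p,
  eq_attempt P le T E -> eq_attempt P le T' E' ->
  a ∈ T -> b ∈ T -> a ∈ T' -> b ∈ T' -> p ∈ P ->
  (triple_in p a b E <-> triple_in p a b E').
Proof.
  revert a b; apply (level_ind2 (fun a b => forall T E T' E' p,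
    eq_attempt P le T E -> eq_attempt P le T' E' ->
    a ∈ T -> b ∈ T -> a ∈ T' -> b ∈ T' -> p ∈ P ->
    (triple_in p a b E <-> triple_in p a b E'))); [dfn|].
  intros a b U HU HaU HbU IH T E T' E' p HE HE' Ha Hb Ha' Hb' Hp.
  rewrite (proj2 HE), (proj2 HE') by assumption.
  apply eq_clause_congr; intros r c d Hr Hc Hd.
  assert (HcU : forall c, in_dom c a \/ in_dom c b -> c ∈ U /\ c ∈ T /\ c ∈ T').
  { destruct HE as [HT _], HE' as [HT' _].
    intros x [Hx|Hx]; repeat split;
      eauto using transitive_dom, in_dom_closed. }
  destruct (HcU c Hc) as [? []], (HcU d Hd) as [? []].
  apply (IH c d) with (T := T) (T' := T'); auto.
Qed.

Lemma forces_eq_attempt (T E p a b : M) :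
  eq_attempt P le T E -> a ∈ T -> b ∈ T -> p ∈ P ->
  (feq p a b <-> triple_in p a b E).
Proof.
  intros HE Ha Hb Hp; split.
  - intros [T' [E' [HE' [Ha' [Hb' H]]]]].
    now apply (attempts_agree a b T E T' E' p).
  - intros H; exists T, E; auto.
Qed.

Lemma forces_eq_attempt_rec (T E p a b : M) :
  eq_attempt P le T E -> a ∈ T -> b ∈ T -> p ∈ P ->
  (feq p a b <-> eq_clause P le feq p a b).
Proof.
  intros HE Ha Hb Hp; rewrite (forces_eq_attempt T E), (proj2 HE) by assumption.
  apply eq_clause_congr; intros r c d Hr Hc Hd; symmetry.
  destruct HE as [HT HE]; apply (forces_eq_attempt T E); auto; [split; auto| |].
  - destruct Hc; [apply (in_dom_closed T c a)|apply (in_dom_closed T c b)]; auto.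
  - destruct Hd; [apply (in_dom_closed T d a)|apply (in_dom_closed T d b)]; auto.
Qed.

Definition triples (T : M) (A : M -> M -> M -> Prop) : M :=
  sep (prod P (prod T T))
    (fun t => exists p c d, t = opair p (opair c d) /\ A p c d).

Lemma in_triples (T : M) (A : M -> M -> M -> Prop) (p c d : M) :
  Def (fun e => A (e 0) (e 1) (e 2)) ->
  (triple_in p c d (triples T A) <-> p ∈ P /\ c ∈ T /\ d ∈ T /\ A p c d).
Proof.
  intros HA; assert (HA' : forall u v w, DT u -> DT v -> DT w ->
    Def (fun e => A (u e) (v e) (w e))) by (intros u v w; now apply Def_app3).
  unfold triples; rewrite triple_in_opair, in_sep, !in_prod_opair by dfn.
  split; [|intros [? [? []]]; eauto 8].
  intros [[Hp [Hc Hd]] [p' [c' [d' [H HA1]]]]].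
  apply opair_inj in H as [-> H]; apply opair_inj in H as [-> ->]; auto.
Qed.

Lemma attempt_exists (a b : M) :
  is_name P a -> is_name P b -> exists T E, eq_attempt P le T E /\ a ∈ T /\ b ∈ T.
Proof.
  revert a b; apply (level_ind2 (fun a b => is_name P a -> is_name P b ->
    exists T E, eq_attempt P le T E /\ a ∈ T /\ b ∈ T)); [dfn|].
  intros a b U HU HaU HbU IH Ha Hb.
  pose (T := cup (sep U (fun y => is_name P y)) (upair a b)).
  assert (HT : forall y, y ∈ T <-> (y ∈ U /\ is_name P y) \/ y = a \/ y = b).
  { intros y; unfold T; rewrite in_cup, in_upair, in_sep by dfn; tauto. }
  assert (HTU : forall y, y ∈ T -> is_name P y /\ subset y U).
  { intros y Hy; apply HT in Hy as [[Hy Hy']|[->| ->]]; auto.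
    split; [assumption|now apply transitive_subset]. }
  assert (Hdom : forall y c, y ∈ T -> in_dom c y -> c ∈ U /\ is_name P c).
  { intros y c Hy Hc; destruct (HTU y Hy).
    split; [apply (transitive_dom U c y)|apply (is_name_dom c y)]; auto. }
  assert (Hrec : forall r c d, r ∈ P -> c ∈ U -> is_name P c -> d ∈ U -> is_name P d ->
    (feq r c d <-> eq_clause P le feq r c d)).
  { intros r c d Hr Hc Hc' Hd Hd'.
    destruct (IH c d) as [T' [E' [HE' []]]]; auto.
    now apply (forces_eq_attempt_rec T' E'). }
  (* No attempts are glued together: by induction [feq] obeys the clause on names in [U], and one
     further application of the clause extends it to [a] and [b]. *)
  pose (E := triples T (eq_clause P le feq)).
  assert (HE : forall p c d, triple_in p c d E <->
    p ∈ P /\ c ∈ T /\ d ∈ T /\ eq_clause P le feq p c d).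
  { intros p c d; apply in_triples; unfold eq_clause, mem_clause; dfn. }
  exists T, E; split; [split|split; apply HT; auto].
  - intros y z Hy Hz; destruct (HTU y Hy) as [[T' [HyT' HT']] _].
    destruct (HT' y z HyT' Hz) as [p [s [Hp [Hs Hps]]]].
    exists p, s; repeat split; auto; apply HT; left; apply (Hdom y); [assumption|].
    exists p, z; auto.
  - intros p c d Hp Hc Hd; rewrite HE.
    assert (Hcongr : eq_clause P le feq p c d <->
      eq_clause P le (fun p a b => triple_in p a b E) p c d); [|tauto].
    apply eq_clause_congr; intros r x y Hr Hx Hy; rewrite HE.
    assert (Hx' : x ∈ U /\ is_name P x) by (destruct Hx; eauto).
    assert (Hy' : y ∈ U /\ is_name P y) by (destruct Hy; eauto).
    rewrite (Hrec r x y) by tauto; rewrite !HT; tauto.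
Qed.

(** Every pair of names lies in some attempt, so the clause holds for all names; later arguments use
    it in place of attempts. *)
Lemma forces_eq_rec (p a b : M) :
  p ∈ P -> is_name P a -> is_name P b ->
  (feq p a b <-> eq_clause P le feq p a b).
Proof.
  intros Hp Ha Hb; destruct (attempt_exists a b Ha Hb) as [T [E [HE []]]].
  now apply (forces_eq_attempt_rec T E).
Qed.

(** The definability theorem for forcing, by induction on [phi] outside [M]. Coordinate 0 holds the
    condition, the later ones the names. *)
Lemma Def_forces (phi : formula) :
  Def (fun e => forces P le phi (fun n => e (S n)) (e 0)).
Proof.
  induction phi as [i j|i j|phi IH|phi IH psi IH2|phi IH]; cbn [forces].
  - dfn.
  - dfn.
  - pose proof (Def_rename (fun n => match n with 0 => 0 | S k => S (S k) end) _ IH).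
    apply (Def_all (fun q e => q ⊴ e 0 -> ~ forces P le phi (fun n => e (S n)) q)).
    dfn.
  - dfn.
  (* Under the three quantifiers of the clause, coordinates 0 to 3 are the name, [r], [q] and the
     original condition; the name parameters start at 4. *)
  - pose proof (Def_rename (fun n =>
      match n with 0 => 1 | 1 => 0 | S (S k) => S (S (S (S k))) end) _ IH) as H.
    assert (H' : Def (fun e =>
      forces P le phi (scons (e 0) (fun n => e (S (S (S (S n)))))) (e 1))).
    { revert H; apply Def_ext; intros e; cbv beta iota.
      match goal with |- forces _ _ _ ?a _ <-> forces _ _ _ ?b _ =>
        replace a with b; [tauto|] end.
      apply functional_extensionality; now intros [|n]. }
    dfn.
Qed.

Lemma Def_forces_param (phi : formula) (rho : nat -> M) (u v : (nat -> M) -> M) :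
  DT u -> DT v -> Def (fun e => forces P le phi (scons (u e) rho) (v e)).
Proof.
  apply (Def_app2 (fun t p => forces P le phi (scons t rho) p)).
  pose proof (Def_subst _ (fun n =>
    match n with 0 => inl 1 | 1 => inl 0 | S (S k) => inr (rho k) end)
    (Def_forces phi)) as H.
  revert H; apply Def_ext; intros e.
  match goal with |- forces _ _ _ ?a _ <-> forces _ _ _ ?b _ =>
    replace a with b; [unfold value; tauto|] end.
  apply functional_extensionality; now intros [|n].
Qed.

(** * Monotonicity, density and substitution for forcing *)

Context (HP : partial_order P le).

Lemma stronger_refl (p : M) : p ∈ P -> p ⊴ p.
Proof. intros Hp; split; [assumption|now apply HP]. Qed.

Lemma stronger_trans (r q p : M) : r ⊴ q -> q ⊴ p -> r ⊴ p.
Proof.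
  intros [Hr Hrq] [Hq Hqp]; split; [assumption|].
  destruct HP as [_ [_ [H _]]]; exact (H r q p Hrq Hqp).
Qed.

Lemma stronger_in (q p : M) : q ⊴ p -> q ∈ P.
Proof. now intros []. Qed.

Lemma forces_mem_mono (q p a b : M) : q ⊴ p -> fmem p a b -> fmem q a b.
Proof. intros Hq Hp r Hr; apply Hp; now apply (stronger_trans r q). Qed.

Lemma forces_mem_dense (p a b : M) :
  (forall q, q ⊴ p -> exists r, r ⊴ q /\ fmem r a b) -> fmem p a b.
Proof.
  intros H q Hq; destruct (H q Hq) as [r [Hr Hf]].
  destruct (Hf r (stronger_refl r (stronger_in _ _ Hr))) as [r' [Hr' Hs]].
  exists r'; split; [now apply (stronger_trans r' r)|assumption].
Qed.

(** As in the clause, only names from the two domains are covered; substitution for arbitrary names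
    has to wait for transitivity. *)
Lemma forces_eq_mem (p a b c q : M) :
  p ∈ P -> is_name P a -> is_name P b -> feq p a b ->
  in_dom c a \/ in_dom c b -> q ⊴ p -> (fmem q c a <-> fmem q c b).
Proof.
  intros Hp Ha Hb H Hc Hq; apply forces_eq_rec in H; auto.
  apply H with (q := q); [|assumption].
  destruct Hc as [[s Hs]|[s Hs]]; exists s; auto.
Qed.

Lemma forces_eq_intro (p a b : M) :
  p ∈ P -> is_name P a -> is_name P b ->
  (forall c q, in_dom c a \/ in_dom c b -> q ⊴ p -> (fmem q c a <-> fmem q c b)) ->
  feq p a b.
Proof.
  intros Hp Ha Hb H; apply forces_eq_rec; auto; intros c [s Hs] q Hq.
  apply H; [|assumption]; destruct Hs; [left|right]; exists s; assumption.
Qed.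

Lemma forces_eq_refl (p a : M) : p ∈ P -> is_name P a -> feq p a a.
Proof. intros Hp Ha; apply forces_eq_intro; tauto. Qed.

Lemma forces_eq_sym (p a b : M) :
  p ∈ P -> is_name P a -> is_name P b -> feq p a b -> feq p b a.
Proof.
  intros Hp Ha Hb H; apply forces_eq_intro; auto; intros c q Hc Hq; symmetry.
  apply (forces_eq_mem p); tauto.
Qed.

Lemma forces_eq_mono (q p a b : M) :
  q ⊴ p -> p ∈ P -> is_name P a -> is_name P b -> feq p a b -> feq q a b.
Proof.
  intros Hq Hp Ha Hb H; apply forces_eq_intro; eauto using stronger_in.
  intros c r Hc Hr; apply (forces_eq_mem p); auto; now apply (stronger_trans r q).
Qed.

Lemma forces_eq_dense (p a b : M) :
  p ∈ P -> is_name P a -> is_name P b ->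
  (forall q, q ⊴ p -> exists r, r ⊴ q /\ feq r a b) -> feq p a b.
Proof.
  intros Hp Ha Hb H; apply forces_eq_intro; auto; intros c q Hc Hq.
  split; intros Hm; apply forces_mem_dense; intros q' Hq';
    destruct (H q') as [r [Hr Hf]]; try (now apply (stronger_trans q' q));
    exists r; (split; [assumption|]);
    assert (Hrq : r ⊴ q) by (now apply (stronger_trans r q'));
    assert (HrP := stronger_in _ _ Hrq);
    apply (forces_eq_mem r a b c r HrP Ha Hb Hf Hc (stronger_refl r HrP));
    now apply (forces_mem_mono r q).
Qed.

Lemma forces_mem_intro (r s c b : M) :
  is_name P b -> pair_in s c b -> r ⊴ s -> fmem r c b.
Proof.
  intros Hb Hc Hr q Hq; exists q; assert (HqP := stronger_in _ _ Hq).
  split; [now apply stronger_refl|]; exists s, c; repeat split; auto.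
  - apply (stronger_trans q r s Hq Hr).
  - apply forces_eq_refl; [assumption|]; now apply (is_name_pair s c b).
Qed.

(** A name [d] forced into [a] is followed through the domains, to ever stronger conditions: [d = e]
    with [e ∈ dom a], then [e = f] with [f ∈ dom b], then [f = g] with [g ∈ dom c]. Two uses of the
    induction hypothesis give [d = g], hence [d ∈ c]. Since [d] may come from [dom a] or [dom c],
    the induction bounds all three ranks at once. *)
Lemma forces_eq_trans (p a b c : M) :
  p ∈ P -> is_name P a -> is_name P b -> is_name P c ->
  feq p a b -> feq p b c -> feq p a c.
Proof.
  revert a b c p; apply (level_ind3 (fun a b c => forall p,
    p ∈ P -> is_name P a -> is_name P b -> is_name P c ->
    feq p a b -> feq p b c -> feq p a c)); [dfn|].
  intros a b c U HU HaU HbU HcU IH.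
  assert (Hnext : forall x y q d, feq q x y -> q ∈ P -> is_name P x -> is_name P y ->
    fmem q d x -> exists e r, in_dom e x /\ r ⊴ q /\ feq r d e /\ fmem r e y).
  { intros x y q d Hxy Hq Hx Hy Hd.
    destruct (Hd q (stronger_refl q Hq)) as [r [Hr [s [e [He [Hrs Hf]]]]]].
    exists e, r; split; [exists s; assumption|]; split; [assumption|].
    split; [assumption|].
    apply (forces_eq_mem q x y e r); auto; [left; exists s; assumption|].
    now apply (forces_mem_intro r s e x). }
  assert (Hhalf : forall x y z p, p ∈ P ->
    is_name P x -> is_name P y -> is_name P z ->
    subset x U -> subset y U -> subset z U -> feq p x y -> feq p y z ->
    forall d q, in_dom d x \/ in_dom d z -> q ⊴ p -> fmem q d x -> fmem q d z).
  { intros x y z p Hp Hx Hy Hz HxU HyU HzU Hxy Hyz d q Hd Hq Hdx.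
    assert (HdU : d ∈ U /\ is_name P d).
    { destruct Hd; [split; [apply (transitive_dom U d x)|apply (is_name_dom d x)]
        |split; [apply (transitive_dom U d z)|apply (is_name_dom d z)]]; auto. }
    apply forces_mem_dense; intros q1 Hq1.
    assert (Hq1p : q1 ⊴ p) by now apply (stronger_trans q1 q).
    destruct (Hnext x y q1 d) as [e [r [He [Hr [Hde Hey]]]]];
      eauto using stronger_in, forces_eq_mono, forces_mem_mono.
    assert (Hrp : r ⊴ p) by now apply (stronger_trans r q1).
    destruct (Hnext y z r e) as [f [r' [Hf [Hr' [Hef Hfz]]]]];
      eauto using stronger_in, forces_eq_mono.
    assert (HeU : e ∈ U /\ is_name P e)
      by (split; [apply (transitive_dom U e x)|apply (is_name_dom e x)]; auto).
    assert (HfU : f ∈ U /\ is_name P f)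
      by (split; [apply (transitive_dom U f y)|apply (is_name_dom f y)]; auto).
    assert (Hr'P := stronger_in _ _ Hr'); assert (HrP := stronger_in _ _ Hr).
    assert (Hdf : feq r' d f).
    { apply (IH d e f); try tauto; now apply (forces_eq_mono r' r). }
    destruct (Hfz r' (stronger_refl _ Hr'P)) as [r2 [Hr2 [s [g [Hg [Hs Hfg]]]]]].
    exists r2; split.
    { apply (stronger_trans r2 r'); [assumption|]; now apply (stronger_trans r' r). }
    assert (Hr2P := stronger_in _ _ Hr2).
    assert (HgU : g ∈ U /\ is_name P g).
    { assert (in_dom g z) by (exists s; assumption).
      split; [apply (transitive_dom U g z)|apply (is_name_dom g z)]; auto. }
    assert (Hdg : feq r2 d g).
    { apply (IH d f g); try tauto; now apply (forces_eq_mono r2 r'). }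
    intros q3 Hq3; exists q3; assert (Hq3P := stronger_in _ _ Hq3).
    split; [now apply stronger_refl|]; exists s, g; split; [assumption|].
    split; [now apply (stronger_trans q3 r2)|].
    now apply (forces_eq_mono q3 r2). }
  intros p Hp Ha Hb Hc Hab Hbc; apply forces_eq_intro; auto.
  intros d q Hd Hq; split.
  - now apply (Hhalf a b c p).
  - apply (Hhalf c b a p); auto using forces_eq_sym; tauto.
Qed.

Lemma forces_mem_subst_l (p a a' b : M) :
  p ∈ P -> is_name P a -> is_name P a' -> is_name P b ->
  feq p a a' -> fmem p a b -> fmem p a' b.
Proof.
  intros Hp Ha Ha' Hb Heq Hm q Hq.
  destruct (Hm q Hq) as [r [Hr [s [c [Hc [Hs Hf]]]]]].
  exists r; split; [assumption|]; exists s, c; split; [assumption|].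
  split; [assumption|]; assert (HrP := stronger_in _ _ Hr).
  apply (forces_eq_trans r a' a c); auto; [now apply (is_name_pair s c b)|].
  apply forces_eq_sym; auto; apply (forces_eq_mono r p); auto.
  now apply (stronger_trans r q).
Qed.

Lemma forces_mem_subst_r (p a b b' : M) :
  p ∈ P -> is_name P a -> is_name P b -> is_name P b' ->
  feq p b b' -> fmem p a b -> fmem p a b'.
Proof.
  intros Hp Ha Hb Hb' Heq Hm; apply forces_mem_dense; intros q Hq.
  destruct (Hm q Hq) as [r [Hr [s [c [Hc [Hs Hf]]]]]].
  exists r; split; [assumption|]; assert (HrP := stronger_in _ _ Hr).
  destruct (is_name_pair s c b Hb Hc) as [_ Hcn].
  apply (forces_mem_subst_l r c a b'); auto using forces_eq_sym.
  apply (forces_eq_mem p b b' c r); auto.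
  - left; exists s; assumption.
  - now apply (stronger_trans r q).
  - now apply (forces_mem_intro r s c b).
Qed.

Lemma is_name_scons (t : M) (rho : nat -> M) :
  is_name P t -> (forall n, is_name P (rho n)) ->
  forall n, is_name P (scons t rho n).
Proof. now intros Ht Hr [|n]; simpl. Qed.

Lemma forces_mono (phi : formula) : forall rho q p,
  (forall n, is_name P (rho n)) -> p ∈ P -> q ⊴ p ->
  forces P le phi rho p -> forces P le phi rho q.
Proof.
  induction phi as [i j|i j|phi IH|phi IH psi IH2|phi IH]; intros rho q p Hrho Hp Hq;
    cbn [forces].
  - now apply forces_mem_mono.
  - now apply forces_eq_mono.
  - intros H r Hr; apply H; now apply (stronger_trans r q).
  - intros [H1 H2]; eauto.
  - intros H r Hr; apply H; now apply (stronger_trans r q).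
Qed.

Lemma forces_dense (phi : formula) : forall rho p,
  (forall n, is_name P (rho n)) -> p ∈ P ->
  (forall q, q ⊴ p -> exists r, r ⊴ q /\ forces P le phi rho r) ->
  forces P le phi rho p.
Proof.
  induction phi as [i j|i j|phi IH|phi IH psi IH2|phi IH]; intros rho p Hrho Hp H;
    cbn [forces] in *.
  - now apply forces_mem_dense.
  - now apply forces_eq_dense.
  - intros q Hq Hphi; destruct (H q Hq) as [r [Hr Hn]].
    assert (HrP := stronger_in _ _ Hr).
    apply (Hn r); [now apply stronger_refl|].
    apply (forces_mono phi rho r q); eauto using stronger_in.
  - split; [apply IH|apply IH2]; auto; intros q Hq;
      destruct (H q Hq) as [r [Hr []]]; eauto.
  - intros q Hq; destruct (H q Hq) as [r [Hr Ht]].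
    destruct (Ht r) as [r' [Hr' Ht']]; [apply stronger_refl, (stronger_in _ _ Hr)|].
    exists r'; split; [now apply (stronger_trans r' r)|assumption].
Qed.

Lemma forces_subst (phi : formula) : forall rho sigma p,
  (forall n, is_name P (rho n)) -> (forall n, is_name P (sigma n)) -> p ∈ P ->
  (forall n, feq p (rho n) (sigma n)) ->
  forces P le phi rho p -> forces P le phi sigma p.
Proof.
  induction phi as [i j|i j|phi IH|phi IH psi IH2|phi IH];
    intros rho sigma p Hr Hs Hp Heq; cbn [forces].
  - intros H; apply (forces_mem_subst_r p _ (rho j)); auto.
    now apply (forces_mem_subst_l p (rho i)).
  - intros H; apply (forces_eq_trans p _ (rho i)); auto using forces_eq_sym.
    now apply (forces_eq_trans p _ (rho j)).
  (* Negation reverses the direction, so the equalities are flipped as well as passed down to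
     [q]. *)
  - intros H q Hq Hf; apply (H q Hq).
    assert (HqP := stronger_in _ _ Hq).
    apply (IH sigma rho q); auto; intros n; apply forces_eq_sym; auto.
    now apply (forces_eq_mono q p).
  - intros [H1 H2]; eauto.
  - intros H q Hq; destruct (H q Hq) as [r [Hrq [t [Ht Hf]]]].
    exists r; split; [assumption|]; exists t; split; [assumption|].
    assert (HrP := stronger_in _ _ Hrq).
    apply (IH (scons t rho)); auto using is_name_scons.
    intros [|n]; simpl; [now apply forces_eq_refl|].
    apply (forces_eq_mono r p); auto; now apply (stronger_trans r q).
Qed.

(** * Mixing of names and the maximum principle from choice *)

Lemma mixing (A : M) (t : M -> M) :
  DT (fun e => t (e 0)) -> subset A P ->
  (forall x y q, x ∈ A -> y ∈ A -> q ⊴ x -> q ⊴ y -> x = y) ->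
  (forall r, r ∈ A -> is_name P (t r)) ->
  exists tau, is_name P tau /\ forall r, r ∈ A -> feq r tau (t r).
Proof.
  intros Dt HAP Hanti Ht; pose proof (fun u => DT_app1 t u Dt) as Dt'.
  destruct (transitive_hull (img A t)) as [U [HU HUtr]].
  (* [P] may lack meets, so a pair [(s, c)] of [t r] enters [tau] under every common lower bound
     [s'] of [r] and [s]. *)
  pose (tau := sep (prod P U) (fun z => exists s' c r s,
    z = opair s' c /\ r ∈ A /\ pair_in s c (t r) /\ s' ⊴ r /\ s' ⊴ s)).
  assert (Htau : forall z, z ∈ tau <-> exists s' c r s,
    z = opair s' c /\ r ∈ A /\ pair_in s c (t r) /\ s' ⊴ r /\ s' ⊴ s).
  { intros z; unfold tau; rewrite in_sep by dfn; split; [tauto|].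
    intros H; split; [|assumption].
    destruct H as [s' [c [r [s [-> [Hr [Hs [Hs'r Hs's]]]]]]]].
    apply in_prod_opair; split; [now apply stronger_in in Hs'r|].
    apply (transitive_dom U c (t r)); [assumption| |exists s; assumption].
    apply transitive_subset; [assumption|]; apply HU.
    apply (in_img A t); [dfn|eauto]. }
  assert (Hpair : forall s' c, pair_in s' c tau <-> exists r s,
    r ∈ A /\ pair_in s c (t r) /\ s' ⊴ r /\ s' ⊴ s).
  { intros s' c; rewrite pair_in_opair, Htau; split.
    - intros [s1 [c1 [r [s [E H]]]]]; apply opair_inj in E as [-> ->]; eauto.
    - intros [r [s H]]; exists s', c, r, s; auto. }
  clearbody tau.
  assert (Hname : is_name P tau).
  { apply is_name_intro; intros z Hz; apply Htau in Hz.
    destruct Hz as [s' [c [r [s [-> [Hr [Hs [Hs'r _]]]]]]]]; exists s', c.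
    split; [now apply stronger_in in Hs'r|]; split; [|reflexivity].
    apply (is_name_pair s c (t r)); auto. }
  exists tau; split; [assumption|]; intros r Hr; apply forces_eq_intro; auto.
  intros c q _ Hq; split; intros Hc q1 Hq1;
    destruct (Hc q1 Hq1) as [q2 [Hq2 [s [d [Hd [Hs Hf]]]]]];
    exists q2; (split; [assumption|]);
    assert (Hq2r : q2 ⊴ r)
      by (apply (stronger_trans q2 q1); [assumption|now apply (stronger_trans q1 q)]).
  (* A pair of [tau] that is active below [r] comes from [t r]: [q2] lies below both [r] and [r'],
     which the antichain allows only if they are equal. *)
  - apply Hpair in Hd as [r' [s1 [Hr' [Hd [Hsr' Hss1]]]]].
    assert (E : r = r').
    { apply (Hanti r r' q2); auto; now apply (stronger_trans q2 s). }
    subst r'; exists s1, d; split; [assumption|]; split; [|assumption].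
    now apply (stronger_trans q2 s).
  (* Conversely [q2] is itself a common lower bound of [r] and [s], so [(q2, d)] is a pair of
     [tau]. *)
  - assert (Hq2P := stronger_in _ _ Hq2).
    exists q2, d; split; [apply (Hpair q2 d); exists r, s; auto|].
    split; [now apply stronger_refl|assumption].
Qed.

Lemma choice_maximum (theta : formula) (rho : nat -> M) (p : M) :
  axiom_of_choice M -> p ∈ P -> (forall n, is_name P (rho n)) ->
  forces P le (Ex theta) rho p ->
  exists t, is_name P t /\ forces P le theta (scons t rho) p.
Proof.
  intros HAC Hp Hrho Hex.
  pose (w r t := is_name P t /\ forces P le theta (scons t rho) r).
  pose proof (Def_forces_param theta rho).
  assert (Dw : forall u v, DT u -> DT v -> Def (fun e => w (u e) (v e)))
    by (unfold w; dfn).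
  pose (D := sep P (fun r => r ⊴ p /\ exists t, w r t)).
  assert (HD : forall r, r ∈ D <-> r ⊴ p /\ exists t, w r t).
  { intros r; unfold D; rewrite in_sep by dfn.
    split; [tauto|intros [Hr Ht]; eauto using stronger_in]. }
  destruct (collection w D) as [B HB]; [dfn|].
  destruct (choice_function B HAC) as [g [Dg Hg]].
  pose proof (fun u => DT_app1 g u Dg) as Dg'.
  (* One choice function on the subsets of [B] serves all [r] and makes [t] a definable term, as
     [mixing] demands. *)
  pose (t r := g (sep B (fun t => w r t))).
  assert (Ht : forall r, r ∈ D -> w r (t r)).
  { intros r Hr.
    assert (HtB : t r ∈ sep B (fun t => w r t)).
    { apply Hg.
      - intros z Hz; rewrite in_sep in Hz by dfn; tauto.
      - destruct (HB r Hr) as [x Hx]; [now apply HD in Hr|].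
        exists x; now apply in_sep; [dfn|]. }
    rewrite in_sep in HtB by dfn; tauto. }
  destruct (maximal_antichain D (fun x y => exists q, q ⊴ x /\ q ⊴ y))
    as [A [HAD [Hanti Hmax]]]; [assumption|dfn| | |].
  { intros d Hd; exists d; apply HD in Hd as [Hd _].
    split; apply stronger_refl, (stronger_in _ _ Hd). }
  { intros x y [q []]; eauto. }
  destruct (mixing A t) as [tau [Htau Heq]].
  { unfold t; dfn. }
  { intros r Hr; apply HAD, HD in Hr as [Hr _]; exact (stronger_in _ _ Hr). }
  { intros x y q Hx Hy Hqx Hqy; apply Hanti; eauto. }
  { intros r Hr; apply (Ht r); auto. }
  exists tau; split; [assumption|]; apply forces_dense; auto using is_name_scons.
  (* The hypothesis puts an element [r] of [D] below [q], and maximality makes [r] compatible with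
     some [a ∈ A]. A common extension forces [tau = t a], so [theta] passes from [t a] to [tau]. *)
  intros q Hq; destruct (Hex q Hq) as [r [Hr Hrt]].
  assert (HrD : r ∈ D).
  { apply HD; split; [now apply (stronger_trans r q)|exact Hrt]. }
  destruct (Hmax r HrD) as [a [Ha [q' [Hq'r Hq'a]]]].
  exists q'; split; [now apply (stronger_trans q' r)|].
  assert (Hq'P := stronger_in _ _ Hq'r).
  destruct (Ht a (HAD a Ha)) as [Hta Hfa].
  assert (HaP : a ∈ P).
  { apply HAD, HD in Ha as [Ha _]; exact (stronger_in _ _ Ha). }
  apply (forces_subst theta (scons (t a) rho)); auto using is_name_scons.
  - intros [|n]; simpl; [|now apply forces_eq_refl].
    apply forces_eq_sym; auto; apply (forces_eq_mono q' a); auto.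
  - apply (forces_mono theta _ q' a); auto using is_name_scons.
Qed.

End Forcing.

(** * Choice from the maximum principle *)

#[local] Hint Resolve Def_stronger Def_is_name Def_forces_eq : dfn.

(** The poset [F ∪ {F}] whose largest element is [F] and whose other elements,
    the members of [F], are pairwise incompatible atoms. *)
Section Fan.

Context (F : M).

Let P : M := succ F.

Definition fan_order : M :=
  sep (prod P P) (fun z => exists x y, z = opair x y /\ (x = y \/ y = F)).

Notation le := fan_order.
Notation "q ⊴ p" := (stronger P le q p) (at level 70, no associativity).

Lemma pair_in_fan_order (x y : M) :
  pair_in x y le <-> x ∈ P /\ y ∈ P /\ (x = y \/ y = F).
Proof.
  unfold fan_order; rewrite pair_in_opair, in_sep, in_prod_opair by dfn; split.
  - intros [[Hx Hy] [x' [y' [E H]]]]; apply opair_inj in E as [-> ->]; auto.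
  - intros [Hx [Hy H]]; eauto 6.
Qed.

Lemma fan_partial_order : partial_order P le.
Proof.
  repeat split.
  - intros z Hz; unfold fan_order in Hz; rewrite in_sep in Hz by dfn.
    destruct Hz as [Hz [x [y [-> _]]]]; apply in_prod_opair in Hz as [Hx Hy].
    exists x, y; repeat split; auto; now apply is_opair_opair.
  - intros p Hp; apply pair_in_fan_order; auto.
  - intros p q r Hpq Hqr; rewrite pair_in_fan_order in Hpq, Hqr |- *.
    destruct Hpq as [? [? [->|]]], Hqr as [? [? [<-|]]]; auto.
  - intros p q Hpq Hqp; rewrite pair_in_fan_order in Hpq, Hqp.
    destruct Hpq as [_ [_ []]], Hqp as [_ [_ []]]; congruence.
Qed.

Lemma fan_top : F ∈ P.
Proof. apply in_succ; auto. Qed.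

Lemma fan_in (x : M) : x ∈ F -> x ∈ P.
Proof. intros H; apply in_succ; auto. Qed.

Lemma fan_below_top (x : M) : x ∈ P -> x ⊴ F.
Proof.
  intros Hx; split; [assumption|]; apply pair_in_fan_order; auto using fan_top.
Qed.

(** Foundation keeps the top apart from the atoms, since [F ∉ F]. As a result, any extension found
    below an atom is the atom itself. *)
Lemma fan_atom (x q : M) : x ∈ F -> q ⊴ x -> q = x.
Proof.
  intros Hx [_ Hq]; apply pair_in_fan_order in Hq as [_ [_ [Hq|Hq]]]; [assumption|].
  subst x; destruct (mem_asym _ _ Hx Hx).
Qed.

Lemma DT_check_step : DT (fun e => prod (upair F F) (e 0)).
Proof. dfn. Qed.

(** The canonical name [{(F, y̌) : y ∈ x}] of [x]. *)
Definition check : M -> M := rec (fun s => prod (upair F F) s).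

Lemma DT_check (u : (nat -> M) -> M) : DT u -> DT (fun e => check (u e)).
Proof. exact (DT_rec _ DT_check_step u). Qed.
#[local] Hint Resolve DT_check : dfn.

Lemma in_check (x z : M) : z ∈ check x <-> exists y, y ∈ x /\ z = opair F (check y).
Proof.
  unfold check at 1; rewrite (rec_eq _ DT_check_step), in_prod; fold check; split.
  - intros [s [c [Hs [Hc ->]]]]; rewrite in_img in Hc by dfn.
    destruct Hc as [y [Hy ->]]; exists y; split; [assumption|].
    apply in_upair in Hs as [->| ->]; reflexivity.
  - intros [y [Hy ->]]; exists F, (check y); rewrite in_upair, in_img by dfn.
    split; [auto|]; split; [exists y; auto|reflexivity].
Qed.

Lemma pair_in_check (s c x : M) :
  pair_in s c (check x) <-> s = F /\ exists y, y ∈ x /\ c = check y.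
Proof.
  rewrite pair_in_opair, in_check; split.
  - intros [y [Hy E]]; apply opair_inj in E as [-> ->]; eauto.
  - intros [-> [y [Hy ->]]]; eauto.
Qed.

Lemma check_name (x : M) : is_name P (check x).
Proof.
  revert x; apply (eps_ind (fun x => is_name P (check x))); [dfn|]; intros x IH.
  apply is_name_intro; intros z Hz; apply in_check in Hz as [y [Hy ->]].
  exists F, (check y); auto using fan_top.
Qed.

Lemma atom_forces_mem_check (X a x : M) :
  X ∈ F -> forces_mem P le X a (check x) ->
  exists y, y ∈ x /\ forces_eq P le X a (check y).
Proof.
  intros HX H.
  destruct (H X) as [r [Hr [s [c [Hc [_ Hf]]]]]].
  { apply stronger_refl, fan_in, HX; exact fan_partial_order. }
  apply fan_atom in Hr as ->; [|assumption].
  apply pair_in_check in Hc as [_ [y [Hy ->]]]; eauto.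
Qed.

(** This turns forced equality at an atom into true equality and so makes the value of [tau] there
    unique. At an atom, a forced member of [check y] equals [check w] for some actual [w ∈ y], and
    ∈-induction applies. *)
Lemma atom_forces_check_inj (X : M) :
  X ∈ F -> forall x y, forces_eq P le X (check x) (check y) -> x = y.
Proof.
  intros HX; assert (HXP := fan_in X HX).
  assert (HP := fan_partial_order).
  apply (eps_ind (fun x =>
    forall y, forces_eq P le X (check x) (check y) -> x = y)); [dfn|].
  intros x IH y Hxy.
  assert (Hdom : forall z u, z ∈ u -> in_dom (check z) (check u)).
  { intros z u Hz; exists F; apply pair_in_check; eauto. }
  assert (Hmem : forall z u, z ∈ u -> forces_mem P le X (check z) (check u)).
  { intros z u Hz; apply (forces_mem_intro P le HP X F); auto using check_name.
    - apply pair_in_check; eauto.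
    - now apply fan_below_top. }
  assert (Htransfer : forall z, z ∈ x \/ z ∈ y ->
    (forces_mem P le X (check z) (check x) <-> forces_mem P le X (check z) (check y))).
  { intros z Hz; apply (forces_eq_mem P le X); auto using check_name, stronger_refl.
    destruct Hz; auto. }
  apply ext; intros z; split; intros Hz.
  - destruct (atom_forces_mem_check X (check z) y HX) as [w [Hw Hzw]].
    { apply Htransfer; auto. }
    now rewrite (IH z Hz w Hzw).
  - destruct (atom_forces_mem_check X (check z) x HX) as [w [Hw Hzw]].
    { apply Htransfer; auto. }
    rewrite <- (IH w Hw z); [assumption|].
    apply forces_eq_sym; auto using check_name.
Qed.

Lemma maximum_choice_for :
  maximum_principle_for M (Mem 0 1) -> (exists X, X ∈ F) ->
  (forall X, X ∈ F -> exists y, y ∈ X) ->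
  exists f, is_function_on f F /\
    forall X, X ∈ F -> exists y, pair_in X y f /\ y ∈ X.
Proof.
  intros HMP HF0 HF; assert (HP := fan_partial_order).
  pose (Gamma := sep (prod F (img (union F) check)) (fun z =>
    exists X y, z = opair X (check y) /\ X ∈ F /\ y ∈ X)).
  assert (HG : forall z, z ∈ Gamma <->
    exists X y, z = opair X (check y) /\ X ∈ F /\ y ∈ X).
  { intros z; unfold Gamma; rewrite in_sep by dfn; split; [tauto|].
    intros H; split; [|assumption]; destruct H as [X [y [-> [HX Hy]]]].
    apply in_prod_opair; split; [assumption|]; rewrite in_img by dfn.
    exists y; split; [apply in_union; eauto|reflexivity]. }
  clearbody Gamma.
  assert (HGn : is_name P Gamma).
  { apply is_name_intro; intros z Hz; apply HG in Hz as [X [y [-> [HX Hy]]]].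
    exists X, (check y); auto using fan_in, check_name. }
  assert (HXG : forall X, X ∈ F -> exists r, r ⊴ X /\
    exists t, is_name P t /\ forces_mem P le r t Gamma).
  { intros X HX; destruct (HF X HX) as [y Hy]; exists X.
    assert (HXX : X ⊴ X) by (apply stronger_refl; auto using fan_in).
    split; [assumption|]; exists (check y); split; [apply check_name|].
    apply (forces_mem_intro P le HP X X); auto.
    apply pair_in_opair, HG; eauto. }
  (* In [Mem 0 1], index 0 is the name sought and index 1 reads the first parameter, [Gamma]. *)
  destruct (proj1 (HMP P le HP F fan_top (fun _ => Gamma) (fun _ => HGn)))
    as [tau [Htau Hmem]].
  { intros q Hq; destruct (proj1 (in_succ F q) (proj1 Hq)) as [HqF| ->].
    - exact (HXG q HqF).
    (* At the top condition an atom has to be found below it, which is where [F] must be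
       nonempty. *)
    - destruct HF0 as [X HX]; destruct (HXG X HX) as [r [Hr Ht]]; exists r.
      split; [|exact Ht].
      apply (stronger_trans P le HP r X); [assumption|].
      apply fan_below_top, fan_in, HX. }
  (* The membership clause is read off directly at [X]: the pair of [Gamma] it supplies carries a
     condition above [X] that is itself an atom, hence [X], and so its [y] is an element of this
     very [X]. *)
  assert (Hval : forall X, X ∈ F ->
    exists y, y ∈ X /\ forces_eq P le X tau (check y)).
  { intros X HX; destruct (Hmem X) as [r [Hr [s [c [Hc [Hs Hf]]]]]].
    { apply fan_below_top, fan_in, HX. }
    apply fan_atom in Hr as ->; [|assumption].
    rewrite pair_in_opair in Hc; apply HG in Hc as [X' [y [E [HX' Hy]]]].
    apply opair_inj in E as [-> ->]; apply fan_atom in Hs as ->; [|assumption].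
    eauto. }
  pose (f := sep (prod F (union F)) (fun z =>
    exists X y, z = opair X y /\ y ∈ X /\ forces_eq P le X tau (check y))).
  assert (Hf : forall X y, pair_in X y f <->
    X ∈ F /\ y ∈ X /\ forces_eq P le X tau (check y)).
  { intros X y; unfold f; rewrite pair_in_opair, in_sep, in_prod_opair by dfn; split.
    - intros [[HX _] [X' [y' [E H]]]]; apply opair_inj in E as [-> ->]; auto.
    - intros [HX [Hy H]]; rewrite in_union.
      split; [split; eauto|exists X, y; auto]. }
  exists f; split; [split|].
  - intros z Hz; unfold f in Hz; rewrite in_sep in Hz by dfn.
    destruct Hz as [Hz [X [y [-> _]]]]; apply in_prod_opair in Hz as [HX _].
    exists X, y; split; [assumption|]; now apply is_opair_opair.
  - intros X HX; destruct (Hval X HX) as [y [Hy Hty]]; exists y.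
    split; [apply Hf; auto|]; intros y' Hy'; apply Hf in Hy' as [_ [_ Hty']].
    assert (HXP := fan_in X HX).
    apply (atom_forces_check_inj X HX).
    apply (forces_eq_trans P le HP X _ tau); auto using check_name.
    apply forces_eq_sym; auto using check_name.
  - intros X HX; destruct (Hval X HX) as [y [Hy Hty]]; exists y.
    split; [apply Hf; auto|assumption].
Qed.

End Fan.

(** The empty family is split off because there [Gamma] would be empty and nothing could be forced
    to belong to it; the empty set is its choice function. *)
Lemma maximum_choice : maximum_principle_for M (Mem 0 1) -> axiom_of_choice M.
Proof.
  intros HMP F HF; destruct (classic (exists X, X ∈ F)) as [HF0|HF0].
  - now apply maximum_choice_for.
  - exists empty; repeat split.
    + intros z Hz; destruct (in_empty z Hz).
    + intros X HX; destruct HF0; eauto.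
    + intros X HX; destruct HF0; eauto.
Qed.

End Model.

Theorem theorem2 (M : mem_structure) (HZF : ZF M) :
  axiom_of_choice M <-> maximum_principle M.
Proof.
  split.
  - intros HAC theta P le HP p Hp rho Hrho; split.
    + now apply choice_maximum.
    (* By monotonicity [t] itself is a witness at every [q] below [p], so this direction holds
       already in ZF. *)
    + intros [t [Ht Hf]] q Hq; exists q; split.
      * apply stronger_refl; [assumption|exact (proj1 Hq)].
      * exists t; split; [assumption|].
        apply (forces_mono HZF P le HP theta _ q p); auto using is_name_scons.
  - intros HMP; exact (maximum_choice HZF (HMP (Mem 0 1))).
Qed.
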